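(* Consider the networked feedback system described in the context, suppose it is mean-square input-output stable, and let the input $\{v(k)\}$ be an i.i.d. process with zero mean and variance $\sigma_v^2$, independent of $\{\tau_n\}$. Then the sequence of variances $\sigma_u^2(k)=\mathbb E\{u^2(k)\}$, $k=0,1,2,\dots$, converges and $$\lim_{k\to\infty}\sigma_u^2(k)=\frac{\|G(z)\|_2^2}{1-\|\Phi(z)G(z)\|_2^2}\,\sigma_v^2.$$
   Context: Setting: $P$ is a SISO discrete-time LTI plant, strictly proper (relative degree $\ge1$), $K$ a proper SISO LTI controller. Let $\tau\ge0$ be an integer, $\mathcal D=\{0,\dots,\tau\}$, $\{\tau_n\}$ i.i.d. with values in $\mathcal D$, $\Pr\{\tau_n=i\}=p_i$, $\sum_ip_i=1$. With real weights $\alpha_i$ and Kronecker delta $\delta$, the channel maps $u$ to $u_d(k)=\sum_{i=0}^{\tau}\alpha_i\delta(\tau_{k-i}-i)u(k-i)$. Closed loop: plant input $v-u_d$, plant output $y$, $u=Ky$; signals real, system at rest at $k=0$. Mean channel $H(z)=\sum_{i=0}^\tau\alpha_ip_iz^{-i}$. Let $\omega(k,n)=\alpha_{k-n}[\delta(\tau_n-(k-n))-p_{k-n}]$ for $n\le k\le n+\tau$, $0$ otherwise, and $d(k)=\sum_{i=0}^\tau\omega(k,k-i)u(k-i)$. Nominal system $G(z)=P(z)K(z)[1+P(z)K(z)H(z)]^{-1}$; the loop is $u=G(v-d)$. Mean-square input-output stable: $G$ stable (poles in open unit disc) and for every input $v$ that is zero-mean white noise with bounded variances and independent of $\{\tau_n\}$,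 $\mathbb E\{d^2(k)\}$ and $\mathbb E\{u^2(k)\}$ are bounded sequences. $\Phi(z)$ is a minimum-phase polynomial in $z^{-1}$ of degree $\tau$ with real coefficients such that $\Phi(z^{-1})\Phi(z)=\frac12\sum_{i_1,i_2=0}^{\tau}(\alpha_{i_1}z^{i_1}-\alpha_{i_2}z^{i_2})(\alpha_{i_1}z^{-i_1}-\alpha_{i_2}z^{-i_2})p_{i_1}p_{i_2}$. $\|F\|_2^2=\frac1{2\pi}\int_{-\pi}^{\pi}|F(e^{j\theta})|^2d\theta$. *)

(* Defs.v *)
From HB Require Import structures.
From mathcomp Require Import all_boot all_order all_algebra.
From mathcomp Require Import all_classical all_reals all_analysis.
From mathcomp Require Import complex.

Set Implicit Arguments.
Unset Strict Implicit.
Unset Printing Implicit Defensive.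

Import Order.TTheory GRing.Theory Num.Theory.
Import numFieldNormedType.Exports.

Local Open Scope classical_set_scope.
Local Open Scope ring_scope.

(* Rational transfer functions.  A SISO LTI transfer function F(z) is given
   as N(w)/D(w), with N D : {poly R} polynomials in the variable w = z^{-1}
   with real coefficients.  Properness is encoded by D`_0 = 1 (normalized),
   strict properness additionally by N`_0 = 0. *)

Section TF.
Variable R : realType.

Definition normc (z : R[i]) : R := ComplexField.Normc.normc z.

Definition cpoly (p : {poly R}) : {poly R[i]} := map_poly (real_complex R) p.

Definition zval (p : {poly R}) (z : R[i]) : R[i] := (cpoly p).[z^-1].

(* poles of N(z^{-1})/D(z^{-1}): the (nonzero) z such that z^{-1} is a root
   of the denominator of the reduced fraction (N/g)/(D/g), g = gcd(N,D).
   (Poles at z = 0 only come from w = oo and always lie in the open disc.) *)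
Definition is_pole (N D : {poly R}) (z : R[i]) : Prop :=
  z != 0 /\ root (cpoly (D %/ gcdp N D)) z^-1.

Definition stable_tf (N D : {poly R}) : Prop :=
  forall z : R[i], is_pole N D z -> normc z < 1.

Definition ejt (t : R) : R[i] := Complex (cos t) (sin t).

Definition H2sq (N D : {poly R}) : R :=
  (2 * pi)^-1 *
  \int[lebesgue_measure]_(t in `[- pi, pi]%classic)
      (normc (zval N (ejt t) / zval D (ejt t)) ^+ 2).

Definition minimum_phase (Phi : {poly R}) : Prop :=
  forall z : R[i], z != 0 -> zval Phi z = 0 -> normc z <= 1.

End TF.

(* The closed loop, computed pathwise for a realization ts of {tau_n} and a
   realization vs of {v(k)}; signals are zero before time 0 (system at rest).
   Plant  : dP(q^-1) y = nP(q^-1) (v - u_d)  (nP`_0 = 0, dP`_0 = 1)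
   Control: dK(q^-1) u = nK(q^-1) y          (dK`_0 = 1)
   Channel: u_d(k) = sum_{i=0}^{tau} alpha_i [ts(k-i) = i] u(k-i).          *)

Section Loop.
Variable R : realType.
Variables (nP dP nK dK : {poly R}) (tau : nat) (alpha : nat -> R).
Variables (ts : nat -> nat) (vs : nat -> R).

Definition loop_step (f : nat -> R * R * R) (k : nat) : R * R * R :=
  let y := fun j => (f j).1.1 in
  let u := fun j => (f j).1.2 in
  let ud := fun j => (f j).2 in
  let e := fun j => vs j - ud j in
  let yk := \sum_(1 <= i < k.+1) nP`_i * e (k - i)%N
            - \sum_(1 <= i < k.+1) dP`_i * y (k - i)%N in
  let y' := fun j => if j == k then yk else y j in
  let uk := \sum_(0 <= i < k.+1) nK`_i * y' (k - i)%N
            - \sum_(1 <= i < k.+1) dK`_i * u (k - i)%N in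
  let u' := fun j => if j == k then uk else u j in
  let udk := \sum_(0 <= i < (minn tau k).+1)
                alpha i * (ts (k - i)%N == i)%:R * u' (k - i)%N in
  (yk, uk, udk).

Fixpoint loop_traj (k : nat) : nat -> R * R * R :=
  match k with
  | 0 => fun _ => (0, 0, 0)
  | k'.+1 => let f := loop_traj k' in
             fun j => if j == k' then loop_step f k' else f j
  end.

Definition loop_y (k : nat) : R := (loop_traj k.+1 k).1.1.
Definition loop_u (k : nat) : R := (loop_traj k.+1 k).1.2.
Definition loop_ud (k : nat) : R := (loop_traj k.+1 k).2.

Definition loop_d (p : nat -> R) (k : nat) : R :=
  \sum_(0 <= i < (minn tau k).+1)
     alpha i * ((ts (k - i)%N == i)%:R - p i) * loop_u (k - i)%N.

End Loop.

(* mean channel H(z) = sum_i alpha_i p_i z^{-i}, as a polynomial in z^{-1} *)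
Definition Hpoly (R : realType) (tau : nat) (alpha p : nat -> R) : {poly R} :=
  \poly_(i < tau.+1) (alpha i * p i).

Section Indep.
Context {d : measure_display} {T : measurableType d} {R : realType}.
Variable P : probability T R.

Definition events_R (X : T -> R) : set (set T) :=
  [set X @^-1` B | B in [set B : set R | measurable B]].
Definition events_nat (X : T -> nat) : set (set T) :=
  [set X @^-1` B | B in [set: set nat]].

Definition mutually_indep (E : nat -> set (set T)) : Prop :=
  forall S : seq nat, uniq S ->
  forall A : nat -> set T, (forall n, n \in S -> E n (A n)) ->
  P (\bigcap_(n in [set` S]) A n) = (\prod_(n <- S) P (A n))%E.

Definition cyl_events (E : nat -> set (set T)) : set (set T) :=
  [set A | exists (S : seq nat) (B : nat -> set T),
      (forall n, n \in S -> E n (B n)) /\ A = \bigcap_(n in [set` S]) B n].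

Definition indep_classes (C1 C2 : set (set T)) : Prop :=
  forall A B, C1 A -> C2 B -> P (A `&` B) = (P A * P B)%E.

Definition indep_processes_R_nat (X : nat -> T -> R) (Y : nat -> T -> nat) :=
  indep_classes (cyl_events (fun n => events_R (X n)))
                (cyl_events (fun n => events_nat (Y n))).

Definition admissible_input (taus : nat -> T -> nat) (w : nat -> T -> R) :=
  [/\ forall k, measurable_fun setT (w k),
      forall k, ('E_P[w k] = 0)%E,
      forall k l, k != l -> ('E_P[fun t => (w k t * w l t)%R] = 0)%E,
      exists M : R, forall k, ('E_P[fun t => (w k t ^+ 2)%R] <= M%:E)%E
    & indep_processes_R_nat w taus].

End Indep.

Definition rv_u (R : realType) (T : Type) (nP dP nK dK : {poly R}) tau alpha
  (taus : nat -> T -> nat) (w : nat -> T -> R) (k : nat) : T -> R :=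
  fun t => loop_u nP dP nK dK tau alpha (fun n => taus n t) (fun n => w n t) k.

Definition rv_d (R : realType) (T : Type) (nP dP nK dK : {poly R}) tau alpha p
  (taus : nat -> T -> nat) (w : nat -> T -> R) (k : nat) : T -> R :=
  fun t => loop_d nP dP nK dK tau alpha (fun n => taus n t) (fun n => w n t) p k.

(* nominal system G = PK/(1+PKH) = nP nK / (dP dK + nP nK H) *)
Definition G_num (R : realType) (nP nK : {poly R}) := nP * nK.
Definition G_den (R : realType) (nP dP nK dK : {poly R}) tau (alpha p : nat -> R) :=
  dP * dK + nP * nK * Hpoly tau alpha p.

Definition ms_io_stable {d : measure_display} {T : measurableType d} {R : realType}
  (P : probability T R) (nP dP nK dK : {poly R}) tau (alpha p : nat -> R)
  (taus : nat -> T -> nat) : Prop :=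
  stable_tf (G_num nP nK) (G_den nP dP nK dK tau alpha p) /\
  forall w : nat -> T -> R, admissible_input P taus w ->
    exists M : R, forall k,
      ('E_P[fun t => (rv_d nP dP nK dK tau alpha p taus w k t ^+ 2)%R] <= M%:E)%E /\
      ('E_P[fun t => (rv_u nP dP nK dK tau alpha taus w k t ^+ 2)%R] <= M%:E)%E.

(* Main.v *)
Require Import Defs.
From HB Require Import structures.
From mathcomp Require Import all_boot all_order all_algebra.
From mathcomp Require Import all_classical all_reals all_analysis.
From mathcomp Require Import measurable_realfun complex ring lra.
Import Order.TTheory GRing.Theory Num.Theory.
Import numFieldNormedType.Exports.
Local Open Scope classical_set_scope.
Local Open Scope ring_scope.

(* Writing [g] for the impulse response of [G], the loop reads
   [u(k) = sum_{n<k} g(k-n) v(n) - sum_{n<k} a(k-n, tau_n) u(n)], where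
   [a(m, t)] is the deviation of [alpha_t g(m-t)] from its mean over [t].  As
   [u(n)] is a combination of the [v(i)] with coefficients depending only on
   [tau_0, ..., tau_{n-1}], it is independent of [tau_n]; all cross terms vanish
   in [E u(k)^2], which gives the renewal equation
   [s(k) = sigma^2 sum_{m<=k} g(m)^2 + sum_{n<k} c(k-n) s(n)] with
   [c(m) = Var a(m, tau_n)].  By Parseval, [sum g^2 = ||G||^2], and the spectral
   factorization gives [sum c = ||Phi G||^2].  The sequence [s] is nondecreasing,
   and bounded by mean-square stability, so it has a limit [L], which satisfies
   [L = sigma^2 ||G||^2 + ||Phi G||^2 L].  If [||Phi G|| = 1] this forces
   [sigma^2 ||G||^2 = 0], whence [s = 0], in agreement with [x / 0 = 0]. *)

(** Transfer functions enter as identities between causal sequences under [conv]: a denominator with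
    constant term 1 can be cancelled, so the loop is solved exactly in the time domain, and
    frequency appears only in the two norms. The spectral identity yields a variance because the
    variance of a finite law is half the mean squared difference of two independent copies, which is
    the shape of the right-hand side defining [Phi]. Independence is assumed on cylinder events
    only. Rather than passing to generated sigma-algebras, the proof keeps [u n] in an explicit
    linear span, where the expectation of a product reduces to cylinder probabilities times moments
    of [v]. Stability constrains the reduced fraction, whereas the norms use the unreduced one,
    whose denominator may vanish on the circle. The common factor is therefore cancelled in the time
    domain, and its finitely many zeros on the circle are discarded as a null set. *)

(** * Convolution of causal sequences, that is, multiplication of power series *)

Definition conv {R : comNzRingType} (a b : nat -> R) (k : nat) : R :=
  \sum_(i < k.+1) a i * b (k - i)%N.

Section Convolution.
Context {R : comNzRingType}.
Implicit Types a b c : nat -> R.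

Lemma conv_coefM (p q : {poly R}) : conv (nth 0 p) (nth 0 q) = nth 0 (p * q).
Proof. by apply/funext => k; rewrite coefM. Qed.

Lemma eq_conv a a' b b' k : (forall i, (i <= k)%N -> a i = a' i) ->
  (forall i, (i <= k)%N -> b i = b' i) -> conv a b k = conv a' b' k.
Proof.
move=> eqa eqb; apply: eq_bigr => i _.
by rewrite eqa -1?ltnS// eqb ?leq_subr.
Qed.

(** Coefficients up to [n] of a product only see coefficients up to [n] of the factors, so the ring
    laws of [conv] are inherited from polynomials by truncation. *)
Let trunc n a : {poly R} := \poly_(i < n.+1) a i.

Let coef_trunc n a i : (i <= n)%N -> (trunc n a)`_i = a i.
Proof. by move=> le_in; rewrite coef_poly ltnS le_in. Qed.

Let conv_trunc n a b i : (i <= n)%N -> (trunc n a * trunc n b)`_i = conv a b i.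
Proof.
move=> le_in; rewrite -conv_coefM; apply: eq_conv => j le_ji;
  by rewrite coef_trunc// (leq_trans le_ji).
Qed.

Lemma convC a b : conv a b = conv b a.
Proof. by apply/funext => k; rewrite -!(@conv_trunc k)// mulrC. Qed.

Lemma convA a b c : conv a (conv b c) = conv (conv a b) c.
Proof.
apply/funext => k; transitivity ((trunc k a * trunc k b * trunc k c)`_k).
  rewrite -mulrA -conv_coefM; apply: eq_conv => i le_ik;
  by rewrite ?coef_trunc ?conv_trunc.
by rewrite -conv_coefM; apply: eq_conv => i le_ik; rewrite ?coef_trunc ?conv_trunc.
Qed.

Lemma convDr a b c : conv a (b \+ c) = conv a b \+ conv a c.
Proof.
by apply/funext => k; rewrite /conv/= -big_split; apply: eq_bigr => i _; rewrite mulrDr.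
Qed.

Lemma convDl a b c : conv (a \+ b) c = conv a c \+ conv b c.
Proof. by rewrite convC convDr !(convC c). Qed.

Lemma convBr a b c : conv a (b \- c) = conv a b \- conv a c.
Proof.
by apply/funext => k; rewrite /conv/= -sumrB; apply: eq_bigr => i _; rewrite mulrBr.
Qed.

Lemma convS a b k : conv a b k = a 0%N * b k + \sum_(i < k) a i.+1 * b (k - i.+1)%N.
Proof. by rewrite /conv big_ord_recl subn0. Qed.

Lemma conv_polyCl (x : R) b : conv (nth 0 x%:P) b = fun k => x * b k.
Proof.
apply/funext => k; rewrite convS coefC/= big1 ?addr0// => i _.
by rewrite coefC mul0r.
Qed.

End Convolution.

(** Coefficient [k] of the product is [a 0 * b k] plus terms in earlier values of [b], so these are
    recovered one after the other. *)
Lemma conv_inj (R : idomainType) (a b c : nat -> R) :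
  a 0%N != 0 -> conv a b = conv a c -> b = c.
Proof.
move=> a0 eqbc; apply/funext => k; elim/ltn_ind: k => k IH.
have := congr1 (@^~ k) eqbc; rewrite /= !convS.
under eq_bigr => i _ do rewrite IH ?ltn_subrL ?(leq_ltn_trans _ (ltn_ord i))//.
by move=> /addIr /(mulfI a0).
Qed.

(** The recursion looks at all earlier values, so [traj n] tabulates the first [n] of them, in the
    same style as [loop_traj]. *)
Lemma exists_strong_rec (A : Type) (x0 : A) (F : nat -> (nat -> A) -> A) :
  (forall k f g, (forall i, (i < k)%N -> f i = g i) -> F k f = F k g) ->
  exists g, forall k, g k = F k g.
Proof.
move=> F_ext.
pose fix traj n := if n isn't m.+1 then fun=> x0 else
  fun j => if j == m then F m (traj m) else traj m j.
exists (fun k => traj k.+1 k) => k /=; rewrite eqxx; apply: F_ext => i.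
elim: k => // k IH; rewrite ltnS leq_eqVlt => /predU1P[-> /=|ltik].
  by rewrite eqxx.
by rewrite {1}/traj ltn_eqF// -/traj IH.
Qed.

(** Applied to a normalized denominator and a numerator, this produces the impulse response of their
    quotient. *)
Lemma exists_conv (R : comNzRingType) (a b : nat -> R) :
  a 0%N = 1 -> exists g, conv a g = b.
Proof.
move=> a0; have [|g gE] := @exists_strong_rec R 0
  (fun k g => b k - \sum_(i < k) a i.+1 * g (k - i.+1)%N).
  move=> k f g fg; congr (_ - _); apply: eq_bigr => i _.
  by rewrite fg// ltn_subrL (leq_ltn_trans _ (ltn_ord i)).
by exists g; apply/funext => k; rewrite convS a0 mul1r gE subrK.
Qed.

(** * The modulus of complex numbers *)

Section Modulus.
Context {R : realType}.
Implicit Types x y : R[i].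

Lemma modulusE x : normc x = Num.sqrt (complex.Re x ^+ 2 + complex.Im x ^+ 2).
Proof. by case: x. Qed.

Lemma modulus_ge0 x : 0 <= normc x.
Proof. by rewrite modulusE sqrtr_ge0. Qed.

Lemma modulusM x y : normc (x * y) = normc x * normc y.
Proof. exact: ComplexField.Normc.normcM. Qed.

Lemma modulusN x : normc (- x) = normc x.
Proof. by case: x => a b; rewrite !modulusE /= !sqrrN. Qed.

Lemma modulusD x y : normc (x + y) <= normc x + normc y.
Proof. exact: le_normcD. Qed.

Lemma modulusB x y : normc (x - y) <= normc x + normc y.
Proof. by rewrite -(modulusN y) modulusD. Qed.

Lemma modulusV x : normc x^-1 = (normc x)^-1.
Proof. exact: ComplexField.Normc.normcV. Qed.

Lemma modulus_eq0 x : (normc x == 0) = (x == 0).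
Proof.
apply/eqP/eqP => [/ComplexField.Normc.eq0_normc//|->].
exact: ComplexField.Normc.normc0.
Qed.

Lemma modulus_real (x : R) : normc (real_complex R x) = `|x|.
Proof. by rewrite modulusE/= expr0n addr0 sqrtr_sqr. Qed.

End Modulus.

(** * Stability makes the impulse response absolutely summable *)

Section Stable.
Context {R : realType}.
Implicit Types f h : nat -> R[i].

Let summable (h : nat -> R[i]) :=
  exists M : R, forall n, \sum_(k < n) normc (h k) <= M.

Lemma summable_poly (q : {poly R[i]}) : summable (nth 0 q).
Proof.
exists (\sum_(k < size q) normc q`_k) => n.
apply: (@le_trans _ _ (\sum_(k < size q + n) normc q`_k)).
  by rewrite addnC big_split_ord/= lerDl sumr_ge0// => i _; exact: modulus_ge0.
rewrite big_split_ord/= [X in _ + X]big1 ?addr0// => i _.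
by rewrite nth_default ?leq_addr//; apply/eqP; rewrite modulus_eq0.
Qed.

(* [`|w| `|h k| <= `|f k| + `|h k.-1|], so the partial sums [S] of [`|h|] satisfy
   [`|w| S <= M + S]. *)
Lemma summable_deconv_linear (w : R[i]) h f : 1 < normc w ->
  conv (nth 0 ('X - w%:P)) h = f -> summable f -> summable h.
Proof.
move=> w1 hf [M fM]; exists (M / (normc w - 1)) => n.
have fE0 : f 0%N = - w * h 0%N.
  by rewrite -hf /conv big_ord1 coefB coefX coefC sub0r.
have fES k : f k.+1 = - w * h k.+1 + h k.
  rewrite -hf convS big_ord_recl big1 => [|i _].
    by rewrite !coefB !coefX !coefC/= sub0r subr0 mul1r subn1 addr0.
  by rewrite coefB coefX coefC subr0 mul0r.
have step m : normc w * \sum_(k < m.+1) normc (h k) <=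
    \sum_(k < m.+1) normc (f k) + \sum_(k < m) normc (h k).
  elim: m => [|m IH].
    by rewrite big_ord0 !big_ord1 addr0 fE0 mulNr modulusN modulusM.
  rewrite big_ord_recr/= mulrDr [X in _ <= X + _]big_ord_recr.
  rewrite [X in _ <= _ + X]big_ord_recr/= addrACA lerD//.
  rewrite -modulusM (_ : w * _ = h m - f m.+1); last by rewrite fES; ring.
  by rewrite addrC modulusB.
rewrite ler_pdivlMr ?subr_gt0// mulrBr mulr1 mulrC lerBlDr.
case: n => [|n]; first by rewrite big_ord0 mulr0 addr0 (le_trans _ (fM 0%N))// big_ord0.
rewrite (le_trans (step n))// lerD// big_ord_recr/= lerDl modulus_ge0//.
Qed.

Lemma summable_deconv_prod (s : seq R[i]) h f :
  {in s, forall w, 1 < normc w} ->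
  conv (nth 0 (\prod_(w <- s) ('X - w%:P))) h = f -> summable f -> summable h.
Proof.
elim: s h f => [|w s IH] h f s1.
  rewrite big_nil conv_polyCl => <-.
  by under [X in summable X -> _]eq_fun do rewrite mul1r.
rewrite big_cons -conv_coefM -convA => hf sf.
apply: (IH h _ _ erefl) => [x xs|]; first by apply: s1; rewrite inE xs orbT.
by apply: summable_deconv_linear hf sf; apply: s1; rewrite mem_head.
Qed.

(** After reduction the denominator splits over the complex numbers into linear factors with roots
    outside the closed disc, and deconvolution by each such factor preserves summability. *)
Lemma stable_tf_summable (N D : {poly R}) (g : nat -> R) :
  D`_0 = 1 -> conv (nth 0 D) g = nth 0 N -> stable_tf N D ->
  exists M : R, forall n, \sum_(k < n) `|g k| <= M.
Proof.
move=> D0 Dg stab; set q := gcdp N D; set D' := D %/ q; set N' := N %/ q.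
have ND : N = q * N' by rewrite mulrC divpK ?dvdp_gcdl.
have DD : D = q * D' by rewrite mulrC divpK ?dvdp_gcdr.
have qD0 : q`_0 * D'`_0 = 1 by rewrite -D0 DD coefM big_ord1.
have q0 : q`_0 != 0 by apply: contra_eq_neq qD0 => ->; rewrite mul0r eq_sym oner_neq0.
have D'0 : D'`_0 != 0 by apply: contra_eq_neq qD0 => ->; rewrite mulr0 eq_sym oner_neq0.
(* The gcd may carry unstable roots, but its constant term is nonzero, so it cancels from the
   convolution equation. *)
have {}Dg : conv (nth 0 D') g = nth 0 N'.
  apply: (@conv_inj _ (nth 0 q) _ _ q0).
  by rewrite convA !conv_coefM -DD -ND.
pose toC := real_complex R.
have nthC (p : {poly R}) : nth 0 (cpoly p) = toC \o nth 0 p.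
  by apply/funext => k; rewrite /cpoly coef_map.
have [s sE] := closed_field_poly_normal (cpoly D').
have lD : lead_coef (cpoly D') != 0.
  rewrite lead_coef_eq0 map_poly_eq0; apply: contraNneq D'0 => ->.
  by rewrite coef0.
have DgC : conv (nth 0 (cpoly D')) (toC \o g) = nth 0 (cpoly N').
  rewrite !nthC -Dg; apply/funext => k; rewrite /conv/= /toC rmorph_sum.
  by apply: eq_bigr => i _; rewrite rmorphM.
suff [M gM] : summable (toC \o g).
  by exists M => n; under eq_bigr do rewrite -modulus_real; exact: gM.
apply: (@summable_deconv_prod s _ (nth 0 ((lead_coef (cpoly D'))^-1 *: cpoly N'))).
(* In the variable [z^-1] poles are inverted: [w] is nonzero because [D'] has a nonzero constant
   term, [w^-1] is a pole, and stability gives [w] modulus above 1. *)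
- move=> w ws; have rw : root (cpoly D') w.
    by rewrite sE rootZ// root_prod_XsubC.
  have w0 : w != 0.
    apply: contraTneq rw => ->; rewrite rootE horner_coef0 nthC/=.
    by rewrite fmorph_eq0.
  have /stab : is_pole N D w^-1 by split; rewrite ?invr_eq0// invrK.
  by rewrite modulusV invf_lt1// lt_def modulus_ge0 modulus_eq0 w0.
- rewrite -mul_polyC -conv_coefM -DgC convA conv_coefM {2}sE -mul_polyC mulrA.
  by rewrite -polyCM mulVf// mul1r.
- exact: summable_poly.
Qed.

End Stable.

(** * Frequency response on the unit circle *)

Section FrequencyResponse.
Context {R : realType}.
Implicit Types (p q : {poly R}) (t : R) (z : R[i]).

Definition gain p t : R := normc (zval p (ejt t)).

Lemma ejtD (a b : R) : ejt (a + b) = ejt a * ejt b.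
Proof. by rewrite /ejt cosD sinD; congr Complex; rewrite addrC. Qed.

Lemma ejt0 : ejt (0 : R) = 1.
Proof. by rewrite /ejt cos0 sin0. Qed.

Lemma ejt_neq0 t : ejt t != 0.
Proof.
apply: contra_eq_neq (ejtD t (- t)) => ->.
by rewrite subrr ejt0 mul0r oner_neq0.
Qed.

Lemma ejtV t : (ejt t)^-1 = ejt (- t).
Proof. by apply: (mulfI (ejt_neq0 t)); rewrite divff ?ejt_neq0// -ejtD subrr ejt0. Qed.

Lemma ejtX t k : ejt t ^+ k = ejt (k%:R * t).
Proof.
elim: k => [|k IH]; first by rewrite expr0 mul0r ejt0.
by rewrite exprS IH -ejtD -natr1 mulrDl mul1r addrC.
Qed.

Lemma normc_ejt t : normc (ejt t) = 1.
Proof. by rewrite modulusE /= cos2Dsin2 sqrtr1. Qed.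

Lemma zvalD p q z : zval (p + q) z = zval p z + zval q z.
Proof. by rewrite /zval /cpoly rmorphD hornerD. Qed.

Lemma zvalB p q z : zval (p - q) z = zval p z - zval q z.
Proof. by rewrite /zval /cpoly rmorphB hornerD hornerN. Qed.

Lemma zvalM p q z : zval (p * q) z = zval p z * zval q z.
Proof. by rewrite /zval /cpoly rmorphM hornerM. Qed.

Lemma zvalC (c : R) z : zval c%:P z = real_complex R c.
Proof. by rewrite /zval /cpoly map_polyC hornerC. Qed.

Lemma zvalXn k z : zval 'X^k z = z ^- k.
Proof. by rewrite /zval /cpoly map_polyXn hornerXn exprVn. Qed.

Lemma gain_ge0 p t : 0 <= gain p t. Proof. exact: modulus_ge0. Qed.

Lemma gainD p q t : gain (p + q) t <= gain p t + gain q t.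
Proof. by rewrite /gain zvalD modulusD. Qed.

Lemma gainB p q t : gain p t - gain q t <= gain (p - q) t.
Proof. by rewrite lerBlDr (le_trans _ (gainD _ _ _))// subrK. Qed.

Lemma gainBC p q t : gain (p - q) t = gain (q - p) t.
Proof. by rewrite /gain !zvalB -opprB modulusN. Qed.

Lemma gainM p q t : gain (p * q) t = gain p t * gain q t.
Proof. by rewrite /gain zvalM modulusM. Qed.

Lemma gainC (c t : R) : gain c%:P t = `|c|.
Proof. by rewrite /gain zvalC modulus_real. Qed.

Lemma gainXn k t : gain 'X^k t = 1.
Proof. by rewrite /gain zvalXn -exprVn ejtV ejtX normc_ejt. Qed.

Lemma gain_sum n (F : 'I_n -> {poly R}) t :
  gain (\sum_(i < n) F i) t <= \sum_(i < n) gain (F i) t.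
Proof.
elim: n F => [|n IH] F; first by rewrite !big_ord0 -(polyC0 R) gainC normr0.
rewrite !big_ord_recr/= (le_trans (gainD _ _ _))// lerD2r IH//.
Qed.

Lemma gain_sqr p t :
  gain p t ^+ 2 = complex.Re (zval p (ejt t)) ^+ 2 + complex.Im (zval p (ejt t)) ^+ 2.
Proof. by rewrite /gain modulusE sqr_sqrtr// addr_ge0// sqr_ge0. Qed.

Lemma conjc_zval p z : conjc (zval p z) = zval p (conjc z).
Proof.
rewrite /zval -(horner_map (@conjc R)) fmorphV /cpoly; congr horner.
rewrite -map_poly_comp; apply: eq_map_poly => x /=.
by rewrite oppr0.
Qed.

(** Real coefficients turn conjugation of the value into inversion of the point of the circle. This
    links the gain to the product of values at [z^-1] and [z] in the spectral identity. *)
Lemma gain_sqrC p t :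
  real_complex R (gain p t ^+ 2) = zval p (ejt t)^-1 * zval p (ejt t).
Proof.
have -> : (ejt t)^-1 = conjc (ejt t) by rewrite ejtV /ejt cosN sinN.
rewrite -conjc_zval gain_sqr; case: (zval _ _) => a b.
by apply/eqP; rewrite eq_complex /=; apply/andP; split; apply/eqP; ring.
Qed.

Lemma continuous_gain_sqr p : continuous (fun t => gain p t ^+ 2).
Proof.
suff [cr ci] : continuous (fun t => complex.Re (zval p (ejt t))) /\
               continuous (fun t => complex.Im (zval p (ejt t))).
  rewrite (funext (gain_sqr p)) => t.
  by apply: cvgD; rewrite expr2; apply: cvgM; [exact: cr|exact: cr|exact: ci|exact: ci].
elim/poly_ind: p => [|p c [cr ci]].
  have z0 t : zval 0 (ejt t) = 0 :> R[i] by rewrite -(polyC0 R) zvalC.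
  have re0 : (fun t => complex.Re (zval 0 (ejt t))) = cst 0 by apply/funext => t; rewrite z0.
  have im0 : (fun t => complex.Im (zval 0 (ejt t))) = cst 0 by apply/funext => t; rewrite z0.
  by rewrite re0 im0; split=> t; exact: cvg_cst.
have zE t : zval (p * 'X + c%:P) (ejt t) = zval p (ejt t) * ejt (- t) + real_complex R c.
  by rewrite zvalD zvalM zvalC -['X]expr1 zvalXn expr1 ejtV.
have reE t : complex.Re (zval (p * 'X + c%:P) (ejt t)) =
    complex.Re (zval p (ejt t)) * cos t + complex.Im (zval p (ejt t)) * sin t + c.
  by rewrite zE; case: (zval p _) => a b /=; rewrite cosN sinN; ring.
have imE t : complex.Im (zval (p * 'X + c%:P) (ejt t)) =
    complex.Im (zval p (ejt t)) * cos t - complex.Re (zval p (ejt t)) * sin t.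
  by rewrite zE; case: (zval p _) => a b /=; rewrite cosN sinN; ring.
rewrite (funext reE) (funext imE); split=> t.
  by apply: cvgD; [apply: cvgD; apply: cvgM|exact: cvg_cst];
    [exact: cr|exact: continuous_cos|exact: ci|exact: continuous_sin].
by apply: cvgB; apply: cvgM;
  [exact: ci|exact: continuous_cos|exact: cr|exact: continuous_sin].
Qed.

End FrequencyResponse.

(** * Averages over the circle and Parseval for polynomials *)

Lemma poly_recr (R : nzRingType) (h : nat -> R) n :
  \poly_(i < n.+1) h i = \poly_(i < n) h i + (h n)%:P * 'X^n.
Proof. by rewrite !poly_def big_ord_recr mul_polyC. Qed.

Section CircleMean.
Context {R : realType}.
Implicit Types (p q : {poly R}) (t : R) (f : R -> R) (h : nat -> R).

Definition circle : set R := `[- pi, pi].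
Notation mu := (@lebesgue_measure R).

Definition mean f : R := (2 * pi)^-1 * \int[mu]_(t in circle) f t.

Lemma measurable_circle : measurable circle.
Proof. exact: measurable_itv. Qed.

Lemma circle_ltNpi_pi : (- pi : R) < pi.
Proof. by rewrite (@lt_trans _ _ 0)// ?oppr_lt0 pi_gt0. Qed.

Lemma twopi_neq0 : 2 * pi != 0 :> R.
Proof. by rewrite mulf_neq0// gt_eqF// pi_gt0. Qed.

Lemma mu_circle : mu circle = (2 * pi)%:E.
Proof.
rewrite /circle lebesgue_measure_itv/= lte_fin circle_ltNpi_pi -EFinD.
by rewrite opprK mulr2n mulrDl mul1r.
Qed.

Lemma meanD f1 f2 : mu.-integrable circle (EFin \o f1) ->
  mu.-integrable circle (EFin \o f2) ->
  mean (fun t => f1 t + f2 t) = mean f1 + mean f2.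
Proof. by move=> i1 i2; rewrite /mean RintegralD// ?mulrDr//; exact: measurable_circle. Qed.

Lemma meanZ r f : mu.-integrable circle (EFin \o f) ->
  mean (fun t => r * f t) = r * mean f.
Proof. by move=> i1; rewrite /mean RintegralZl// 1?mulrCA//; exact: measurable_circle. Qed.

Lemma mean_cst r : mean (fun=> r) = r.
Proof.
rewrite /mean Rintegral_cst; last exact: measurable_circle.
by have /= -> := mu_circle; rewrite mulrCA mulVf ?mulr1// twopi_neq0.
Qed.

Lemma integrableZl_circle r f : mu.-integrable circle (EFin \o f) ->
  mu.-integrable circle (EFin \o (fun t => r * f t)).
Proof.
move=> i1; rewrite (_ : _ \o _ = (fun t => r%:E * (EFin \o f) t)%E).
  by apply: integrableZl => //; exact: measurable_circle.
by apply/funext => t; rewrite /= EFinM.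
Qed.

Lemma integrableD_circle f1 f2 : mu.-integrable circle (EFin \o f1) ->
  mu.-integrable circle (EFin \o f2) ->
  mu.-integrable circle (EFin \o (fun t => f1 t + f2 t)).
Proof.
move=> i1 i2; rewrite (_ : _ \o _ = (EFin \o f1) \+ (EFin \o f2))%E//.
by apply: integrableD => //; exact: measurable_circle.
Qed.

Lemma mean_sum n (F : 'I_n -> R -> R) :
  (forall i, mu.-integrable circle (EFin \o F i)) ->
  mu.-integrable circle (EFin \o (fun t => \sum_(i < n) F i t)) /\
  mean (fun t => \sum_(i < n) F i t) = \sum_(i < n) mean (F i).
Proof.
elim: n F => [|n IH] F iF.
  rewrite (_ : (fun t => _) = cst 0); last by apply/funext => t; rewrite big_ord0.
  rewrite big_ord0 mean_cst; split=> //; exact: integrable0.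
have [i1 m1] := IH _ (fun i => iF (widen_ord (leqnSn n) i)).
rewrite (_ : (fun t => _) = fun t =>
   \sum_(i < n) F (widen_ord (leqnSn n) i) t + F ord_max t); last first.
  by apply/funext => t; rewrite big_ord_recr.
rewrite big_ord_recr meanD// m1; split=> //.
exact: integrableD_circle.
Qed.

Lemma continuous_integrable_circle f : continuous f ->
  mu.-integrable circle (EFin \o f).
Proof.
move=> cf; apply: continuous_compact_integrable; first exact: segment_compact.
exact: continuous_subspaceT.
Qed.

Lemma continuous_cosM (c : R) : continuous (fun t => cos (c * t)).
Proof.
move=> t; apply: (@continuous_comp _ _ _ ( *%R c) cos); last exact: continuous_cos.
exact: mulrl_continuous.
Qed.

(** The antiderivative [sin (k t) / k] vanishes at both end points. *)
Lemma mean_cos (k : nat) : (0 < k)%N -> mean (fun t => cos (k%:R * t)) = 0.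
Proof.
move=> k0; have kR : k%:R != 0 :> R by rewrite pnatr_eq0 -lt0n.
pose F (t : R) : R := sin (k%:R * t) / k%:R.
have dF t : is_derive t (1 : R) F (cos (k%:R * t)).
  rewrite /F; apply: is_derive_eq; rewrite /GRing.scale/=.
  by field.
have cF : continuous F.
  by move=> t; apply: differentiable_continuous; apply/derivable1_diffP; case: (dF t).
rewrite /mean /Rintegral (@continuous_FTC2 _ _ F)//=.
- rewrite /F mulrN sinN.
  have -> : sin (k%:R * pi) = 0 :> R.
    elim: (k) => [|m IH]; first by rewrite mul0r sin0.
    by rewrite -natr1 mulrDl mul1r sinDpi IH oppr0.
  by rewrite oppr0 mul0r subrr mulr0.
- exact: circle_ltNpi_pi.
- exact/continuous_subspaceT/continuous_cosM.
- split; [by move=> x _; case: (dF x)| |].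
  + by apply: cvg_at_right_filter; exact: cF.
  + by apply: cvg_at_left_filter; exact: cF.
- by move=> x _; rewrite derive1E; case: (dF x).
Qed.

Lemma zval_poly h n t :
  zval (\poly_(i < n) h i) (ejt t) =
  Complex (\sum_(i < n) h i * cos (i%:R * t)) (- \sum_(i < n) h i * sin (i%:R * t)).
Proof.
elim: n => [|n IH].
  by rewrite poly_def !big_ord0 -(polyC0 R) zvalC oppr0.
rewrite poly_recr zvalD IH zvalM zvalC zvalXn -exprVn ejtV ejtX mulrN.
rewrite !big_ord_recr/= /ejt cosN sinN.
by apply/eqP; rewrite eq_complex/=; apply/andP; split; apply/eqP; ring.
Qed.

Lemma mean_gain_poly h n :
  mean (fun t => gain (\poly_(i < n) h i) t ^+ 2) = \sum_(i < n) h i ^+ 2.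
Proof.
elim: n => [|n IH].
  rewrite big_ord0 -[RHS](mean_cst 0); congr mean; apply/funext => t.
  by rewrite poly_def big_ord0 -(polyC0 R) gainC normr0 expr0n.
(* Adding the coefficient [h n] creates cross terms that oscillate at the frequencies [n - k], all
   positive, hence of mean zero. *)
pose c t := \sum_(k < n) h k * cos ((n - k)%:R * t).
have gE t : gain (\poly_(i < n.+1) h i) t ^+ 2 =
    gain (\poly_(i < n) h i) t ^+ 2 + (h n ^+ 2 + 2 * h n * c t).
  have -> : c t = (\sum_(i < n) h i * cos (i%:R * t)) * cos (n%:R * t) +
                  (\sum_(i < n) h i * sin (i%:R * t)) * sin (n%:R * t).
    rewrite !mulr_suml -big_split; apply: eq_bigr => k _ /=.
    rewrite natrB 1?ltnW// mulrBl cosB; ring.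
  rewrite !gain_sqr !zval_poly !big_ord_recr/=.
  have CS : cos (n%:R * t) ^+ 2 = 1 - sin (n%:R * t) ^+ 2.
    by have := cos2Dsin2 (n%:R * t); lra.
  by ring: CS.
have intc k : mu.-integrable circle (EFin \o (fun t => cos ((n - k)%:R * t))).
  exact/continuous_integrable_circle/continuous_cosM.
have [intS mS] := @mean_sum n (fun k t => h k * cos ((n - k)%:R * t))
  (fun k : 'I_n => @integrableZl_circle (h k) _ (intc k)).
have {}mS : mean c = 0.
  by rewrite mS big1// => k _; rewrite meanZ// mean_cos ?subn_gt0// mulr0.
have i1 : mu.-integrable circle (EFin \o (cst (h n ^+ 2))).
  by apply/continuous_integrable_circle => t; exact: cvg_cst.
have i2 := @integrableZl_circle (2 * h n) _ intS.
under [X in mean X]eq_fun do rewrite gE.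
rewrite meanD; last 2 first.
- exact/continuous_integrable_circle/continuous_gain_sqr.
- exact: integrableD_circle.
by rewrite IH big_ord_recr/= meanD// mean_cst meanZ// mS mulr0 addr0.
Qed.

End CircleMean.

(** * Parseval for rational transfer functions *)

Lemma cvg_sum_ord {R : realType} n (F : 'I_n -> nat -> R) (l : 'I_n -> R) :
  (forall i, F i @ \oo --> l i) ->
  (fun k => \sum_(i < n) F i k) @ \oo --> \sum_(i < n) l i.
Proof.
by move=> Fl; apply: cvg_big => [|i _]; [exact: add_continuous|exact: Fl].
Qed.

Section Parseval.
Context {R : realType}.
Implicit Types (p q N D : {poly R}) (t : R) (h : nat -> R).
Notation mu := (@lebesgue_measure R).

Lemma H2sqE N D : H2sq N D = mean (fun t => (gain N t / gain D t) ^+ 2).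
Proof.
by rewrite /H2sq /mean; congr (_ * Rintegral _ _ _); apply/funext => t;
  rewrite modulusM modulusV.
Qed.

Lemma gain_poly_le h n t : gain (\poly_(i < n) h i) t <= \sum_(i < n) `|h i|.
Proof.
elim: n => [|n IH]; first by rewrite poly_def !big_ord0 -(polyC0 R) gainC normr0.
rewrite poly_recr big_ord_recr/= (le_trans (gainD _ _ _))//.
by rewrite gainM gainC gainXn mulr1 lerD2r.
Qed.

Lemma poly_sub_split h m n : (m <= n)%N ->
  \poly_(i < n) h i - \poly_(i < m) h i = 'X^m * \poly_(i < n - m) h (m + i)%N.
Proof.
move=> le_mn; apply/polyP => i; rewrite coefB !coef_poly coefXnM coef_poly.
case: (ltnP i m) => [lt_im|le_mi]; first by rewrite (leq_trans lt_im le_mn) subrr.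
by rewrite subr0 ltn_sub2rE// subnKC.
Qed.

(** A shift has unit gain, so the tail is bounded by the tail of the absolute series, uniformly in
    [t]. *)
Lemma gain_poly_sub_le h m n t : (m <= n)%N ->
  gain (\poly_(i < n) h i - \poly_(i < m) h i) t <=
  \sum_(i < n) `|h i| - \sum_(i < m) `|h i|.
Proof.
move=> le_mn; rewrite poly_sub_split// gainM gainXn mul1r.
rewrite (le_trans (gain_poly_le _ _ _))// lerBrDl.
have -> : \sum_(i < n) `|h i| = \sum_(i < m + (n - m)) `|h i| by rewrite subnKC.
by rewrite big_split_ord.
Qed.

(** Shortening the [j]-th shift of [h] so that it stops below degree [n] removes all overflow, so
    the identity is exact. Hence [D] times the full truncation differs from [N] only by finitely
    many shifted tails. *)
Lemma deconv_remainder N D h n : conv (nth 0 D) h = nth 0 N -> (size N <= n)%N ->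
  N = \sum_(j < size D) D`_j *: ('X^j * \poly_(i < n - j) h i).
Proof.
move=> DhN le_Nn; apply/polyP => m; rewrite coef_sum.
under eq_bigr => j _ do rewrite coefZ coefXnM coef_poly.
case: (ltnP m n) => [lt_mn|le_nm]; last first.
  rewrite nth_default ?(leq_trans le_Nn)// big1// => j _.
  by rewrite (ltnNge (m - j)) leq_sub2r// if_same mulr0.
rewrite -DhN /conv.
pose F j := if (j <= m)%N then D`_j * h (m - j)%N else 0.
transitivity (\sum_(j < m.+1 + size D) F j).
  rewrite big_split_ord/= [X in _ = _ + X]big1 ?addr0 => [|j _].
    by apply: eq_bigr => j _; rewrite /F -ltnS ltn_ord.
  by rewrite /F leqNgt leq_addr.
rewrite addnC big_split_ord/= [X in _ + X]big1 ?addr0 => [|j _]; last first.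
  by rewrite /F nth_default ?leq_addr// mul0r if_same.
apply: eq_bigr => j _; rewrite /F leqNgt; case: ltnP => [|le_jm]; first by rewrite mulr0.
by rewrite ltn_sub2rE ?lt_mn.
Qed.

Lemma deconv_gain_le N D h n t : conv (nth 0 D) h = nth 0 N -> (size N <= n)%N ->
  `|gain D t * gain (\poly_(i < n) h i) t - gain N t| <=
  \sum_(j < size D) `|D`_j| * (\sum_(i < n) `|h i| - \sum_(i < n - j) `|h i|).
Proof.
move=> DhN le_Nn; set H := \poly_(i < n) h i.
apply: (@le_trans _ _ (gain (D * H - N) t)).
  rewrite -gainM ler_norml gainB andbT lerNl opprB.
  by rewrite (le_trans (gainB _ _ _))// gainBC.
have -> : D * H - N = \sum_(j < size D) D`_j *: ('X^j * (H - \poly_(i < n - j) h i)).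
  rewrite [in N in _ - N](deconv_remainder _ _ _ _ DhN le_Nn) -{1}(coefK D) poly_def.
  rewrite mulr_suml -sumrB; apply: eq_bigr => j _.
  by rewrite mulrBr scalerBr -scalerAl.
rewrite (le_trans (gain_sum _ _ _))// ler_sum// => j _.
rewrite -mul_polyC !gainM gainC gainXn mul1r ler_wpM2l//.
by rewrite gain_poly_sub_le// leq_subr.
Qed.

Lemma deconv_gain_cvg N D h (M : R) t : conv (nth 0 D) h = nth 0 N ->
  (forall n, \sum_(k < n) `|h k| <= M) -> gain D t != 0 ->
  (fun n => gain (\poly_(i < n) h i) t) @ \oo --> gain N t / gain D t.
Proof.
move=> DhN hM D0; pose S n := \sum_(k < n) `|h k|.
have /cvg_ex[l Sl] : cvgn S.
  apply: nondecreasing_is_cvgn; last by exists M => _ [n _ <-]; exact: hM.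
  by apply/nondecreasing_seqP => n; rewrite /S big_ord_recr/= lerDl.
have S0 (j : nat) : (fun n => `|D`_j| * (S n - S (n - j)%N)) @ \oo --> (0 : R).
  rewrite [X in _ --> X](_ : _ = `|D`_j| * (l - l)); last by rewrite subrr mulr0.
  apply: cvgM; first exact: cvg_cst.
  by apply: cvgB => //; exact: (cvg_comp _ S (cvg_subnr j) Sl).
have eps0 := cvg_sum_ord _ _ _ (fun j : 'I_(size D) => S0 j).
rewrite big1 // in eps0.
have DH : (fun n => gain D t * gain (\poly_(i < n) h i) t) @ \oo --> gain N t.
  apply/cvgrPdist_le => e e0; near=> n; rewrite distrC.
  have le_n : (size N <= n)%N by near: n; exact: nbhs_infty_ge.
  apply: (le_trans (deconv_gain_le _ _ _ _ t DhN le_n)).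
  rewrite (le_trans (ler_norm _))//.
  by near: n; move/cvgr0_norm_le: eps0; apply.
rewrite mulrC (_ : (fun n => _) =
   (fun n => (gain D t)^-1 * (gain D t * gain (\poly_(i < n) h i) t))).
  by apply: cvgM => //; exact: cvg_cst.
by apply/funext => n; rewrite mulKf.
Unshelve. all: by end_near. Qed.

(** A zero at [t] means that [ejt (- t)] is a root of [D]; its real part is [cos t], so each root
    accounts for at most the two values [acos] and [- acos]. *)
Lemma finite_zero_gain D : D != 0 -> finite_set [set t | circle t /\ gain D t = 0].
Proof.
move=> D0.
have [s sE] := closed_field_poly_normal (cpoly D).
have lD : lead_coef (cpoly D) != 0 by rewrite lead_coef_eq0 map_poly_eq0.
pose f (w : R[i]) := acos (complex.Re w).
apply: (@sub_finite_set _ _ ((f @` [set` s]) `|` ((fun w => - f w) @` [set` s]))).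
  move=> t [/=]; rewrite /circle /= in_itv/= => /andP[t1 t2].
  move=> /eqP; rewrite modulus_eq0 /zval ejtV => rt.
  have ws : ejt (- t) \in s.
    by rewrite -root_prod_XsubC -(rootZ _ _ lD) -sE.
  case: (leP 0 t) => t0.
    by left; exists (ejt (- t)) => //; rewrite /f /ejt /= cosN cosK// in_itv/= t0.
  right; exists (ejt (- t)) => //; rewrite /f /ejt /= cosN cosKN ?opprK//.
  by rewrite t1 ltW.
by rewrite finite_setU; split; apply: finite_image; exact: finite_seq.
Qed.

(** The truncations satisfy the finite identity and converge pointwise off the zeros of [D]. Their
    squared gains are dominated by the constant [M ^+ 2], so the limit passes under the integral. *)
Lemma parseval N D h (M : R) : D != 0 -> conv (nth 0 D) h = nth 0 N ->
  (forall n, \sum_(k < n) `|h k| <= M) ->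
  mu.-integrable circle (EFin \o (fun t => (gain N t / gain D t) ^+ 2)) /\
  (fun n => \sum_(i < n) h i ^+ 2) @ \oo --> H2sq N D.
Proof.
move=> D0 DhN hM; pose H n := \poly_(i < n) h i.
have mgain p : measurable_fun circle (fun t => gain p t ^+ 2).
  apply: measurable_funTS; apply: continuous_measurable_fun.
  exact: continuous_gain_sqr.
have := @dominated_convergence _ _ R mu _ (@measurable_circle R)
  (fun n t => (gain (H n) t ^+ 2)%:E) (fun t => ((gain N t / gain D t) ^+ 2)%:E)
  (fun=> (M ^+ 2)%:E).
case.
- by move=> n; apply/measurable_EFinP; exact: mgain.
- apply/measurable_EFinP.
  (* The reciprocal is read as the power [-1], which agrees with it also at the zeros of [gain D],
     where both are 0. *)
  rewrite (_ : (fun t => _) = (fun t => gain N t ^+ 2 * (gain D t ^+ 2) `^ (-1))).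
    apply: measurable_funM; first exact: mgain.
    exact: (measurableT_comp (measurable_powR (-1)) (mgain D)).
  by apply/funext => t; rewrite powR_inv1 ?sqr_ge0// exprMn exprVn.
- exists [set t | circle t /\ gain D t = 0]; split.
  + apply: countable_measurable; first by move=> x; exact: measurable_set1.
    exact/finite_set_countable/finite_zero_gain.
  + by apply: countable_lebesgue_measure0; exact/finite_set_countable/finite_zero_gain.
  + move=> t /= /not_implyP[ct nc]; split=> //; apply: contrapT => /eqP gD0; apply: nc.
    apply: cvg_EFin; first exact: nearW.
    by apply: cvgM; exact: (deconv_gain_cvg _ _ _ _ _ DhN hM).
- apply: continuous_integrable_circle => t; exact: cvg_cst.
- apply: aeW => t n _ /=.
  have gM : gain (H n) t <= M by apply: le_trans (hM n); exact: gain_poly_le.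
  rewrite lee_fin ger0_norm ?sqr_ge0// lerXn2r// ?nnegrE ?gain_ge0//.
  exact: le_trans (gain_ge0 _ _) gM.
move=> intf _ lim; split=> //.
rewrite H2sqE (_ : (fun n => _) = (fun n => mean (fun t => gain (H n) t ^+ 2))).
  apply: cvgM; first exact: cvg_cst.
  have fint : (\int[mu]_(t in circle) ((gain N t / gain D t) ^+ 2)%:E)%E \is a fin_num.
    by apply: integrable_fin_num; [exact: measurable_circle|exact: intf].
  by apply: fine_cvg; rewrite fineK.
by apply/funext => n; rewrite mean_gain_poly.
Qed.

End Parseval.

(** * The spectral factor and the variance injected by the channel *)

Section SpectralFactor.
Context {R : realType}.
Implicit Types (N D Q : {poly R}) (t : R) (g h : nat -> R).
Notation mu := (@lebesgue_measure R).

Lemma conv_X g : conv (nth 0 'X) g = fun m => if m is m'.+1 then g m' else 0.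
Proof.
apply/funext => -[|m]; rewrite convS coefX mul0r add0r; first by rewrite big_ord0.
rewrite big_ord_recl coefX mul1r subn1 big1 ?addr0// => i _.
by rewrite coefX mul0r.
Qed.

Lemma conv_Xn i g m :
  conv (nth 0 'X^i) g m = if (m < i)%N then 0 else g (m - i)%N.
Proof.
elim: i m => [|i IH] m; first by rewrite conv_polyCl mul1r subn0.
rewrite exprS -conv_coefM -convA conv_X.
by case: m => // m; rewrite IH ltnS subSS.
Qed.

Lemma conv_poly_summable Q g M : (forall n, \sum_(k < n) `|g k| <= M) ->
  exists M', forall n, \sum_(k < n) `|conv (nth 0 Q) g k| <= M'.
Proof.
move=> gM; elim/poly_ind: Q => [|Q c [M' QM']].
  by exists 0 => n; rewrite -(polyC0 R) conv_polyCl big1// => i _; rewrite mul0r normr0.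
exists (M' + `|c| * M) => n.
have nthD : nth 0 (Q * 'X + c%:P) = nth 0 (Q * 'X) \+ nth 0 c%:P.
  by apply/funext => k; rewrite coefD.
rewrite nthD convDl conv_polyCl mulrC -conv_coefM -convA conv_X.
apply: (@le_trans _ _ (\sum_(k < n) (`|if k : nat is k'.+1 then conv (nth 0 Q) g k' else 0|
    + `|c| * `|g k|))).
  by apply: ler_sum => k _; rewrite -normrM; exact: ler_normD.
rewrite big_split; apply: lerD; last by rewrite -mulr_sumr ler_wpM2l// gM.
case: n => [|n]; first by rewrite big_ord0 (le_trans _ (QM' 0%N))// big_ord0.
by rewrite big_ord_recl/= normr0 add0r; exact: QM'.
Qed.

Variables (tau : nat) (alpha p phi : nat -> R).
Hypothesis spectral : forall z : R[i], z != 0 ->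
  zval (\poly_(i < tau.+1) phi i) z^-1 * zval (\poly_(i < tau.+1) phi i) z =
  (2 : R[i])^-1 *
  \sum_(i1 < tau.+1) \sum_(i2 < tau.+1)
     (real_complex R (alpha i1) * z ^+ i1 - real_complex R (alpha i2) * z ^+ i2) *
     (real_complex R (alpha i1) * z ^- i1 - real_complex R (alpha i2) * z ^- i2) *
     real_complex R (p i1 * p i2).

(** The factors of the spectral identity: on the circle its right-hand side is a weighted sum of the
    squared gains of the [Q i j]. *)
Let Q i j : {poly R} := (alpha i)%:P * 'X^i - (alpha j)%:P * 'X^j.
Let Phi := \poly_(i < tau.+1) phi i.

Lemma gain_spectral t : gain Phi t ^+ 2 =
  2^-1 * \sum_(i < tau.+1) \sum_(j < tau.+1) p i * p j * gain (Q i j) t ^+ 2.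
Proof.
suff : real_complex R (gain Phi t ^+ 2) = real_complex R
  (2^-1 * \sum_(i < tau.+1) \sum_(j < tau.+1) p i * p j * gain (Q i j) t ^+ 2) by case.
rewrite gain_sqrC spectral ?ejt_neq0//.
rewrite rmorphM fmorphV rmorph_nat rmorph_sum; congr (_ * _).
apply: eq_bigr => i _; rewrite rmorph_sum; apply: eq_bigr => j _.
transitivity (real_complex R (gain (Q i j) t ^+ 2) * real_complex R (p i * p j)).
  rewrite gain_sqrC /Q; congr (_ * _).
  by rewrite !zvalB !zvalM !zvalC !zvalXn !exprVn !invrK.
by rewrite -rmorphM mulrC.
Qed.

(** Impulse response of [alpha i * z^-i * G]: the effect on the loop, at lag [m], of a unit sample
    delayed by [i]. *)
Definition tap g (i m : nat) : R := if (m < i)%N then 0 else alpha i * g (m - i)%N.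

Definition tap_var g (m : nat) : R :=
  \sum_(i < tau.+1) p i * (tap g i m - \sum_(j < tau.+1) p j * tap g j m) ^+ 2.

(** Explains the factor one half in the spectral identity: for independent copies the mean of the
    squared difference is twice the variance. *)
Lemma weighted_variance n (w x : 'I_n -> R) : \sum_i w i = 1 ->
  \sum_i w i * (x i - \sum_j w j * x j) ^+ 2 =
  2^-1 * \sum_i \sum_j w i * w j * (x i - x j) ^+ 2.
Proof.
move=> w1; set mx := \sum_j w j * x j; pose s := \sum_i w i * x i ^+ 2.
have -> : \sum_i w i * (x i - mx) ^+ 2 = s - mx ^+ 2.
  transitivity (\sum_i (w i * x i ^+ 2 - 2 * mx * (w i * x i) + mx ^+ 2 * w i)).
    by apply: eq_bigr => i _; ring.
  by rewrite big_split/= sumrB -!mulr_sumr -/mx w1 -/s; ring.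
have -> : \sum_i \sum_j w i * w j * (x i - x j) ^+ 2 = 2 * (s - mx ^+ 2).
  transitivity (\sum_i (w i * x i ^+ 2 - 2 * mx * (w i * x i) + s * w i)).
    apply: eq_bigr => i _.
    transitivity (\sum_j (w i * x i ^+ 2 * w j - 2 * (w i * x i) * (w j * x j)
       + w i * (w j * x j ^+ 2))).
      by apply: eq_bigr => j _; ring.
    by rewrite big_split/= sumrB -!mulr_sumr -/mx w1 -/s; ring.
  by rewrite big_split/= sumrB -!mulr_sumr -/mx w1 -/s; ring.
by rewrite mulKf// pnatr_eq0.
Qed.

(** By [weighted_variance] the series is a weighted sum, over pairs of taps, of the energies of
    [Q i j] convolved with [g]. Parseval treats each pair, and [gain_spectral] reassembles the pairs
    under the integral. *)
Lemma tap_var_series N D g M : D != 0 -> conv (nth 0 D) g = nth 0 N ->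
  (forall n, \sum_(k < n) `|g k| <= M) -> \sum_(i < tau.+1) p i = 1 ->
  (fun n => \sum_(m < n) tap_var g m) @ \oo --> H2sq (Phi * N) D.
Proof.
move=> D0 DgN gM p1.
have QhE i j m : conv (nth 0 (Q i j)) g m = tap g i m - tap g j m.
  have nthB : nth 0 (Q i j) = nth 0 ((alpha i)%:P * 'X^i) \- nth 0 ((alpha j)%:P * 'X^j).
    by apply/funext => k; rewrite coefB.
  rewrite nthB convC convBr ![conv g _]convC -!conv_coefM -!convA !conv_polyCl/= !conv_Xn.
  by rewrite /tap; case: (ltnP m i); case: (ltnP m j); rewrite ?mulr0/=.
have Qparseval i j : mu.-integrable circle
     (EFin \o (fun t => (gain (Q i j * N) t / gain D t) ^+ 2)) /\
   (fun n => \sum_(m < n) conv (nth 0 (Q i j)) g m ^+ 2) @ \oo --> H2sq (Q i j * N) D.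
  have [M' hM'] := conv_poly_summable (Q i j) g M gM.
  apply: parseval hM' => //.
  by rewrite convA conv_coefM mulrC -conv_coefM -convA DgN conv_coefM.
rewrite (_ : H2sq _ _ = 2^-1 * \sum_(i < tau.+1) \sum_(j < tau.+1)
    p i * p j * H2sq (Q i j * N) D).
  rewrite (_ : (fun n => _) = (fun n => 2^-1 * \sum_(i < tau.+1) \sum_(j < tau.+1)
     p i * p j * \sum_(m < n) conv (nth 0 (Q i j)) g m ^+ 2)).
    apply: cvgM; first exact: cvg_cst.
    apply: cvg_sum_ord => i; apply: cvg_sum_ord => j.
    by apply: cvgM; [exact: cvg_cst|exact: (Qparseval i j).2].
  apply/funext => n.
  transitivity (\sum_(m < n) 2^-1 * \sum_(i < tau.+1) \sum_(j < tau.+1)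
      p i * p j * conv (nth 0 (Q i j)) g m ^+ 2).
    apply: eq_bigr => m _; rewrite /tap_var weighted_variance//; congr (_ * _).
    by apply: eq_bigr => i _; apply: eq_bigr => j _; rewrite QhE.
  rewrite -mulr_sumr exchange_big; congr (_ * _); apply: eq_bigr => i _.
  rewrite exchange_big; apply: eq_bigr => j _.
  by rewrite mulr_sumr.
have i1 i j := integrableZl_circle (p i * p j) _ (Qparseval i j).1.
have i2 (i : 'I_tau.+1) := mean_sum tau.+1 _ (fun j : 'I_tau.+1 => i1 i j).
have [i3 m3] := mean_sum tau.+1 _ (fun i => (i2 i).1).
rewrite H2sqE -[RHS](_ : 2^-1 * mean (fun t => \sum_(i < tau.+1) \sum_(j < tau.+1)
   p i * p j * (gain (Q i j * N) t / gain D t) ^+ 2) = _); last first.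
  rewrite m3; congr (_ * _); apply: eq_bigr => i _; rewrite (i2 i).2.
  by apply: eq_bigr => j _; rewrite meanZ ?H2sqE//; exact: (Qparseval i j).1.
rewrite -meanZ//; congr mean; apply/funext => t.
rewrite gainM expr_div_n exprMn gain_spectral -!mulrA; congr (_ * _).
rewrite mulr_suml; apply: eq_bigr => i _; rewrite mulr_suml; apply: eq_bigr => j _.
by rewrite gainM !exprMn exprVn !mulrA.
Qed.

End SpectralFactor.

(** * The closed loop in the time domain *)

Lemma big_minn (V : nmodType) (a b : nat) (F : nat -> V) :
  \sum_(0 <= i < (minn a b).+1) F i = \sum_(i < b.+1) if (i <= a)%N then F i else 0.
Proof.
rewrite -(big_mkord xpredT (fun i => if (i <= a)%N then F i else 0)).
rewrite [RHS](@big_cat_nat _ _ _ (minn a b).+1)//= ?ltnS ?geq_minr//.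
rewrite [X in _ = _ + X]big_nat_cond [X in _ = _ + X]big1 ?addr0 => [|i /andP[/andP[+ +] _]].
  by apply: eq_big_nat => i /=; rewrite ltnS leq_min => /andP[-> _].
rewrite gtn_min ltnS => /orP[|ltbi leib]; first by rewrite ltnNge => /negbTE ->.
by move: ltbi; rewrite ltnNge leib.
Qed.

(** The weights depend on the emission time, so the inner sum is not itself a convolution;
    regrouping by emission time leaves one convolution with [g] for each emitted sample. *)
Lemma conv_triangle {R : comNzRingType} (w : nat -> nat -> R) (u g : nat -> R) k :
  conv (fun m => \sum_(i < m.+1) w (m - i)%N i * u (m - i)%N) g k =
  \sum_(n < k.+1) conv (w n) g (k - n)%N * u n.
Proof.
transitivity (\sum_(m < k.+1) \sum_(n < k.+1 | (n <= m)%N)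
    w n (m - n)%N * u n * g (k - m)%N).
  apply: eq_bigr => m _; rewrite mulr_suml.
  rewrite [LHS](reindex_inj rev_ord_inj)/=.
  under eq_bigr => i _ do rewrite subSS subKn -1?ltnS//.
  by rewrite (big_ord_widen k.+1 (fun n => w n (m - n)%N * u n * g (k - m)%N)).
rewrite (exchange_big_dep xpredT)//=; apply: eq_bigr => n _.
have -> : \sum_(m < k.+1 | (n <= m)%N) w n (m - n)%N * u n * g (k - m)%N =
    \sum_(n <= m < k.+1) w n (m - n)%N * u n * g (k - m)%N.
  by rewrite big_geq_mkord.
rewrite -{1}(add0n n) big_addn subSn -1?ltnS// big_mkord mulr_suml.
apply: eq_bigr => i _; rewrite addnK mulrAC; congr (_ * _ * _).
by rewrite addnC subnDA.
Qed.

Section Loop.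
Context {R : realType}.
Variables (nP dP nK dK : {poly R}) (tau : nat) (alpha p : nat -> R).
Variables (ts : nat -> nat) (vs : nat -> R).
Hypotheses (nP0 : nP`_0 = 0) (dP0 : dP`_0 = 1) (dK0 : dK`_0 = 1).

Let traj := loop_traj nP dP nK dK tau alpha ts vs.
Let y := loop_y nP dP nK dK tau alpha ts vs.
Let u := loop_u nP dP nK dK tau alpha ts vs.
Let ud := loop_ud nP dP nK dK tau alpha ts vs.

Lemma loop_traj_stable k j : (j < k)%N -> traj k j = (y j, u j, ud j).
Proof.
have -> : (y j, u j, ud j) = traj j.+1 j.
  by rewrite /y /u /ud /loop_y /loop_u /loop_ud -/traj; case: (traj j.+1 j) => [[]].
elim: k => // k IH; rewrite ltnS leq_eqVlt => /predU1P[->//|ltjk].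
by rewrite {1}/traj /= ltn_eqF// -/traj IH.
Qed.

Lemma sum_shift1 (F : nat -> R) k : \sum_(1 <= i < k.+1) F i = \sum_(i < k) F i.+1.
Proof. by rewrite big_add1 big_mkord. Qed.

Lemma ltn_subS k (i : 'I_k) : (k - i.+1 < k)%N.
Proof. by rewrite ltn_subrL (leq_ltn_trans _ (ltn_ord i)). Qed.

Lemma loop_plant : conv (nth 0 dP) y = conv (nth 0 nP) (vs \- ud).
Proof.
apply/funext => k; rewrite !convS nP0 dP0 mul0r add0r mul1r.
have -> : y k = \sum_(i < k) nP`_i.+1 * (vs \- ud) (k - i.+1)%N -
                \sum_(i < k) dP`_i.+1 * y (k - i.+1)%N; last by rewrite subrK.
rewrite {1}/y /loop_y /= eqxx /loop_step /= !sum_shift1 -/traj.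
by congr (_ - _); apply: eq_bigr => i _; rewrite loop_traj_stable ?ltn_subS.
Qed.

Lemma loop_yE k : y k = (loop_step nP dP nK dK tau alpha ts vs (traj k) k).1.1.
Proof. by rewrite /y /loop_y /= eqxx. Qed.

Lemma loop_uE k : u k = (loop_step nP dP nK dK tau alpha ts vs (traj k) k).1.2.
Proof. by rewrite /u /loop_u /= eqxx. Qed.

Lemma loop_udE k : ud k = (loop_step nP dP nK dK tau alpha ts vs (traj k) k).2.
Proof. by rewrite /ud /loop_ud /= eqxx. Qed.

Lemma loop_controller : conv (nth 0 dK) u = conv (nth 0 nK) y.
Proof.
apply/funext => k; rewrite [LHS]convS dK0 mul1r.
have -> : u k = conv (nth 0 nK) y k - \sum_(i < k) dK`_i.+1 * u (k - i.+1)%N;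
  last by rewrite subrK.
rewrite loop_uE /loop_step /= !sum_shift1 big_mkord.
congr (_ - _); apply: eq_bigr => i _; last by rewrite loop_traj_stable ?ltn_subS.
congr (_ * _); case: eqP => [->|/eqP nik]; first by rewrite loop_yE /loop_step /= !sum_shift1.
by rewrite loop_traj_stable// ltn_neqAle nik leq_subr.
Qed.

Lemma loop_channel k : ud k =
  \sum_(i < k.+1) (if (i <= tau)%N then alpha i * (ts (k - i)%N == i)%:R else 0)
    * u (k - i)%N.
Proof.
rewrite loop_udE {1}/loop_step; cbv zeta; rewrite [LHS]/= big_minn.
apply: eq_bigr => i _; case: ifP => _; last by rewrite mul0r.
congr (_ * _); case: eqP => [->|/eqP nik]; first by rewrite loop_uE.
by rewrite loop_traj_stable// ltn_neqAle nik leq_subr.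
Qed.

(** The coefficient [omega(n + i, n)] of the channel when [tau_n = t]. *)
Definition channel_weight (t i : nat) : R :=
  if (i <= tau)%N then alpha i * ((t == i)%:R - p i) else 0.

Definition loop_noise k := \sum_(i < k.+1) channel_weight (ts (k - i)%N) i * u (k - i)%N.

Lemma loop_noiseE : loop_noise = ud \- conv (nth 0 (Hpoly tau alpha p)) u.
Proof.
apply/funext => k; rewrite /= loop_channel -sumrB; apply: eq_bigr => i _.
rewrite coef_poly ltnS /channel_weight; case: ifP => _; last by rewrite !mul0r subr0.
by rewrite mulrBr mulrBl.
Qed.

(** This is [u = G (v - d)]. Both sides are compared after convolution with the denominator of [G],
    where the plant and controller equations combine, and the mean channel is moved from [ud] to the
    left. *)
Lemma loop_closed (g : nat -> R) :
  conv (nth 0 (G_den nP dP nK dK tau alpha p)) g = nth 0 (G_num nP nK) ->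
  u = conv g (vs \- loop_noise).
Proof.
move=> Dg; apply: (@conv_inj _ (nth 0 (G_den nP dP nK dK tau alpha p))).
  by rewrite coefD !coefM !big_ord1 dP0 dK0 subn0 coefM big_ord1 nP0 !mul0r addr0 mulr1 oner_neq0.
rewrite convA Dg /G_den /G_num.
have -> : nth 0 (dP * dK + nP * nK * Hpoly tau alpha p) =
    nth 0 (dP * dK) \+ nth 0 (nP * nK * Hpoly tau alpha p).
  by apply/funext => k; rewrite coefD.
rewrite convDl -(conv_coefM dP) -convA loop_controller convA (convC (nth 0 dP)) -convA.
rewrite loop_plant convA conv_coefM (mulrC nK) -(conv_coefM _ (Hpoly _ _ _)).
rewrite -(convA _ _ u) -convDr; congr conv; apply/funext => k.
by rewrite loop_noiseE /=; ring.
Qed.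

Definition tap_dev (g : nat -> R) (m t : nat) : R :=
  tap alpha g t m - \sum_(j < tau.+1) p j * tap alpha g j m.

Lemma conv_channel_weight g t m : (t <= tau)%N ->
  conv (channel_weight t) g m = tap_dev g m t.
Proof.
move=> ht; transitivity (\sum_(j < tau.+1) ((t == j)%:R - p j) * tap alpha g j m).
  transitivity (\sum_(0 <= i < (minn tau m).+1)
      alpha i * ((t == i)%:R - p i) * g (m - i)%N).
    rewrite big_minn; apply: eq_bigr => i _.
    by rewrite /channel_weight; case: ifP => // _; rewrite mul0r.
  (* The range [minn tau m] is unfolded from its other end: lags up to [m] suit the convolution,
     delays up to [tau] suit the taps. *)
  rewrite minnC big_minn; apply: eq_bigr => i _; rewrite /tap.
  by case: leqP => _; rewrite ?mulr0//; ring.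
under eq_bigr do rewrite mulrBl.
rewrite sumrB; congr (_ - _).
rewrite (bigD1 (inord t))//= inordK// eqxx mul1r big1 ?addr0// => i.
rewrite -val_eqE /= inordK// eq_sym => /negbTE ->.
by rewrite mul0r.
Qed.

Lemma loop_u_rec (g : nat -> R) k :
  conv (nth 0 (G_den nP dP nK dK tau alpha p)) g = nth 0 (G_num nP nK) ->
  (forall n, ts n <= tau)%N ->
  u k = \sum_(n < k) g (k - n)%N * vs n - \sum_(n < k) tap_dev g (k - n)%N (ts n) * u n.
Proof.
move=> Dg ts_le.
(* Strict properness of the plant. It kills the terms at time [k], so that [u k] involves only
   [ts n] with [n < k]. *)
have g0 : g 0%N = 0.
  have := congr1 (@^~ 0%N) Dg; rewrite /conv big_ord1 subn0 /G_den /G_num.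
  by rewrite coefD !coefM !big_ord1 dP0 dK0 subn0 coefM big_ord1 nP0 !mul0r addr0 !mul1r.
have tap0 i : tap alpha g i 0%N = 0.
  by rewrite /tap; case: i => // ; rewrite subnn g0 mulr0.
have dev0 t : tap_dev g 0%N t = 0.
  by rewrite /tap_dev tap0 big1 ?subr0// => i _; rewrite tap0 mulr0.
rewrite {1}(loop_closed g Dg) convBr /=; congr (_ - _).
  rewrite convC /conv big_ord_recr/= subnn g0 mulr0 addr0.
  by apply: eq_bigr => n _; rewrite mulrC.
rewrite convC /loop_noise (conv_triangle (fun n => channel_weight (ts n)) u).
rewrite big_ord_recr/= subnn conv_channel_weight// dev0 mul0r addr0.
by apply: eq_bigr => n _; rewrite conv_channel_weight.
Qed.

End Loop.

(** * Expectations and independence *)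

Section Expectation.
Context {d : measure_display} {T : measurableType d} {R : realType}.
Variable P : probability T R.
Implicit Types (X Y : T -> R) (c : R).

(** Integrability is bundled with the value, since linearity of the integral needs it at every
    step. *)
Definition has_expectation X c :=
  P.-integrable setT (EFin \o X) /\ 'E_P[X]%E = c%:E.

Lemma has_expectation_cst c : has_expectation (cst c) c.
Proof. by split; [exact: finite_measure_integrable_cst|exact: expectation_cst]. Qed.

Lemma has_expectationD X Y a b : has_expectation X a -> has_expectation Y b ->
  has_expectation (fun w => X w + Y w) (a + b).
Proof.
rewrite /has_expectation expectation.unlock => -[iX EX] [iY EY]; split.
  rewrite (_ : _ \o _ = (EFin \o X) \+ (EFin \o Y))%E//.
  exact: integrableD.
by under eq_integral do rewrite EFinD; rewrite (integralD measurableT iX iY) EX EY.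
Qed.

Lemma has_expectationZ X r a : has_expectation X a ->
  has_expectation (fun w => r * X w) (r * a).
Proof.
rewrite /has_expectation expectation.unlock => -[iX EX]; split.
  rewrite (_ : _ \o _ = fun w => r%:E * (EFin \o X) w)%E//.
  exact: integrableZl.
by under eq_integral do rewrite EFinM; rewrite (integralZl measurableT iX) EX.
Qed.

Lemma has_expectation_sum n (X : 'I_n -> T -> R) (a : 'I_n -> R) :
  (forall i, has_expectation (X i) (a i)) ->
  has_expectation (fun w => \sum_(i < n) X i w) (\sum_(i < n) a i).
Proof.
elim: n X a => [|n IH] X a Xa.
  rewrite big_ord0 (_ : (fun _ => _) = cst 0); first exact: has_expectation_cst.
  by apply/funext => w; rewrite big_ord0.
rewrite big_ord_recr (_ : (fun _ => _) = fun w =>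
  \sum_(i < n) X (widen_ord (leqnSn n) i) w + X ord_max w).
  by apply: has_expectationD; [exact: (IH _ (fun i => a (widen_ord (leqnSn n) i)))|].
by apply/funext => w; rewrite big_ord_recr.
Qed.

Lemma has_expectation_inj X a b : has_expectation X a -> has_expectation X b -> a = b.
Proof. by move=> [_ Ea] [_ Eb]; apply: EFin_inj; rewrite -Ea. Qed.

Lemma has_expectation_indic A : measurable A -> has_expectation (\1_A) (fine (P A)).
Proof.
move=> mA; split; first exact: integrable_indic.
by rewrite expectation_indic// fineK// fin_num_measure.
Qed.

(** The joint law agrees with the product law on rectangles, hence everywhere; Tonelli gives
    integrability of the product and Fubini its value. *)
Lemma has_expectation_indep X Y a b :
  has_expectation X a -> has_expectation Y b ->
  (forall A B : set R, measurable A -> measurable B ->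
    P (X @^-1` A `&` Y @^-1` B) = (P (X @^-1` A) * P (Y @^-1` B))%E) ->
  has_expectation (fun w => X w * Y w) (a * b).
Proof.
move=> [iX EX] [iY EY] XY.
have mX : measurable_fun setT X by apply/measurable_EFinP; case/integrableP: iX.
have mY : measurable_fun setT Y by apply/measurable_EFinP; case/integrableP: iY.
pose X' : {RV P >-> R} := mfun_Sub (mem_set mX).
pose Y' : {RV P >-> R} := mfun_Sub (mem_set mY).
have mZ : measurable_fun setT (fun w => (X w, Y w)) by exact: measurable_fun_pair.
pose Z : {RV P >-> (R * R)%type} := mfun_Sub (mem_set mZ).
pose mu := distribution P X'; pose nu := distribution P Y'.
have muE : forall S, measurable S -> (mu \x nu)%E S = distribution P Z S.
  apply: product_measure_unique => A B mA mB.
  by rewrite /mu /nu /distribution /pushforward /= -XY.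
pose f (xy : R * R) := (xy.1 * xy.2)%:E.
have mf : measurable_fun setT f.
  by apply/measurable_EFinP; apply: measurable_funM.
have mabs : measurable_fun setT (fun x : R => `|x%:E|%E).
  exact: (measurableT_comp (@abse_measurable R setT) (@EFin_measurable R setT)).
have absX : (\int[mu]_x `|x%:E| < +oo)%E.
  rewrite ge0_integral_distribution//.
  by have [_ h] := integrableP _ _ _ iX; exact: h.
have absY : (\int[nu]_x `|x%:E| < +oo)%E.
  rewrite ge0_integral_distribution//.
  by have [_ h] := integrableP _ _ _ iY; exact: h.
have imuX : mu.-integrable setT EFin.
  by apply/integrableP; split; [exact: EFin_measurable|exact: absX].
have inuY : nu.-integrable setT EFin.
  by apply/integrableP; split; [exact: EFin_measurable|exact: absY].
have imunu : (mu \x nu)%E.-integrable setT f.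
  apply/integrable12ltyP => //.
  have -> : (\int[mu]_x \int[nu]_y `|f (x, y)| = \int[mu]_x (`|x%:E| * \int[nu]_y `|y%:E|))%E.
    apply: eq_integral => x _; rewrite -ge0_integralZl//.
    by apply: eq_integral => y _; rewrite /f EFinM abseM.
  rewrite ge0_integralZr//; last exact: integral_ge0.
  by apply: lte_mul_pinfty => //; [exact: integral_ge0|rewrite ge0_fin_numE// integral_ge0].
have iZ : P.-integrable setT (f \o Z).
  apply/integrableP; split; first exact: measurableT_comp.
  have [_] := integrableP _ _ _ imunu.
  rewrite (eq_measure_integral (distribution P Z)); last by move=> S mS _; exact: muE.
  by rewrite ge0_integral_distribution//; exact: measurableT_comp.
split => //.
rewrite expectation.unlock -[LHS](integral_distribution mf iZ).
rewrite (eq_measure_integral (mu \x nu)%E); last by move=> S mS _; exact/esym/muE.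
rewrite -integral12_prod_meas1// /fubini_F.
have EXmu : (\int[mu]_x x%:E = a%:E)%E.
  by rewrite integral_distribution// -EX expectation.unlock.
have EYnu : (\int[nu]_x x%:E = b%:E)%E.
  by rewrite integral_distribution// -EY expectation.unlock.
have -> : (\int[mu]_x \int[nu]_y f (x, y) = \int[mu]_x (x%:E * b%:E))%E.
  apply: eq_integral => x _; rewrite -EYnu -integralZl//.
by rewrite /= integralZr// EXmu.
Qed.

End Expectation.

Section IndicatorIndependence.
Context {d : measure_display} {T : measurableType d} {R : realType}.
Variable P : probability T R.

Lemma indep_setC (A B : set T) : measurable A -> measurable B ->
  P (A `&` B) = (P A * P B)%E -> P (~` A `&` B) = (P (~` A) * P B)%E.
Proof.
move=> mA mB AB; have -> : ~` A `&` B = B `\` (A `&` B).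
  by rewrite setDIr setDv setU0 setDE setIC.
rewrite measureD//; last 2 first.
- exact: measurableI.
- by rewrite (le_lt_trans (probability_le1 _ _))// ltry.
have -> : B `&` (A `&` B) = A `&` B by rewrite setICA setIid.
rewrite [X in (_ - X)%E]AB probability_setC//.
by rewrite muleBl ?fin_num_measure// ?mul1e.
Qed.

(** Independence is known only for events inside [A]. The variable [\1_A * X] is 0 off [A], so a set
    avoiding 0 has a preimage of that kind, and a set containing 0 is treated through its
    complement. *)
Lemma has_expectation_indic_indep (A : set T) (X Y : T -> R) (a b : R) :
  measurable A -> measurable_fun setT X ->
  has_expectation P (fun w => \1_A w * X w) a -> has_expectation P Y b ->
  (forall S1 S2 : set R, measurable S1 -> measurable S2 ->
    P (A `&` X @^-1` S1 `&` Y @^-1` S2) = (P (A `&` X @^-1` S1) * P (Y @^-1` S2))%E) ->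
  has_expectation P (fun w => \1_A w * X w * Y w) (a * b).
Proof.
move=> mA mX AX EY AXY; apply: has_expectation_indep => // S1 S2 mS1 mS2.
have mY : measurable_fun setT Y by apply/measurable_EFinP; case/integrableP: EY.1.
set Z := fun w => _.
have mYS : measurable (Y @^-1` S2) by rewrite -[X in measurable X]setTI; exact: mY.
have Zout S : ~ S 0 -> Z @^-1` S = A `&` X @^-1` S.
  move=> S0; apply/seteqP; split=> w; rewrite /Z /preimage /= indicE.
    by case: (boolP (w \in A)) => wA; rewrite ?mul1r ?mul0r//; split=> //; rewrite -inE.
  by move=> [/mem_set ->]; rewrite mul1r.
have mAX S : measurable S -> measurable (A `&` X @^-1` S).
  by move=> mS; apply: measurableI => //; rewrite -[X in measurable X]setTI; exact: mX.
case: (pselect (S1 0)) => [S0|S0]; last by rewrite Zout// AXY.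
have -> : Z @^-1` S1 = ~` (A `&` X @^-1` (~` S1)).
  rewrite -(Zout (~` S1)); last by move=> nS0; exact: nS0.
  by rewrite preimage_setC setCK.
by apply: indep_setC => //; [exact/mAX/measurableC|rewrite AXY//; exact: measurableC].
Qed.

End IndicatorIndependence.

(** * Delays, inputs and the span that contains the loop signals *)

Section Processes.
Context {d : measure_display} {T : measurableType d} {R : realType}.
Variable P : probability T R.
Variables (taus : nat -> T -> nat) (v : nat -> T -> R) (sigma2 : R).
Hypothesis taus_meas : forall n i, measurable (taus n @^-1` [set i]).
Hypothesis taus_indep : mutually_indep P (fun n => events_nat (taus n)).
Hypothesis v_meas : forall k, measurable_fun setT (v k).
Hypothesis v_indep : mutually_indep P (fun n => events_R (v n)).
Hypothesis v_mean : forall k, ('E_P[v k] = 0)%E.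
Hypothesis v_var : forall k, ('V_P[v k] = sigma2%:E)%E.
Hypothesis v_taus : indep_processes_R_nat P v taus.

Lemma measurable_taus n (S : set nat) : measurable (taus n @^-1` S).
Proof.
have -> : taus n @^-1` S = \bigcup_(i in S) (taus n @^-1` [set i]).
  apply/seteqP; split=> [w Sw|w [i Si] /= wi]; first by exists (taus n w).
  by rewrite wi.
by apply: bigcup_measurable => i _; exact: taus_meas.
Qed.

Definition cylinder n (B : nat -> set nat) : set T :=
  [set w | forall j, (j < n)%N -> B j (taus j w)].

Lemma cylinderE n B : cylinder n B = \bigcap_(j in [set` iota 0 n]) (taus j @^-1` B j).
Proof.
by apply/seteqP; split=> w Bw j; [rewrite /= mem_iota; exact: Bw|
  move=> ltjn; apply: Bw; rewrite /= mem_iota].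
Qed.

Lemma measurable_cylinder n B : measurable (cylinder n B).
Proof.
by rewrite cylinderE; apply: bigcap_measurableType => j _; exact: measurable_taus.
Qed.

Lemma cylinder_events n B : cyl_events (fun n => events_nat (taus n)) (cylinder n B).
Proof.
exists (iota 0 n), (fun j => taus j @^-1` B j); split; last exact: cylinderE.
by move=> j _; exists (B j).
Qed.

Lemma probability_cylinder n B :
  P (cylinder n B) = (\prod_(j <- iota 0 n) P (taus j @^-1` B j))%E.
Proof.
by rewrite cylinderE taus_indep ?iota_uniq// => j _; exists (B j).
Qed.

Lemma probability_cylinderS n B :
  P (cylinder n.+1 B) = (P (cylinder n B) * P (taus n @^-1` B n))%E.
Proof. by rewrite !probability_cylinder -[n.+1]addn1 iotaD big_cat/= big_seq1. Qed.

Lemma cylinderI n B B' : cylinder n B `&` cylinder n B' = cylinder n (fun j => B j `&` B' j).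
Proof.
apply/seteqP; split=> [w [h h'] j ltjn|w h]; first by split; [exact: h|exact: h'].
by split=> j /h [].
Qed.

Lemma cylinder_widen n B :
  cylinder n B = cylinder n.+1 (fun j => if (j < n)%N then B j else setT).
Proof.
apply/seteqP; split=> w h j ltj; first by case: ifP => // /h.
by have := h j (ltnW ltj); rewrite ltj.
Qed.

Lemma cylinder_extend n B S : cylinder n B `&` taus n @^-1` S =
  cylinder n.+1 (fun j => if (j < n)%N then B j else S).
Proof.
apply/seteqP; split=> [w [h hS] j|w h].
  by rewrite ltnS leq_eqVlt => /predU1P[->|ltjn]; [rewrite ltnn|rewrite ltjn; exact: h].
split=> [j ltjn|]; first by have := h j (ltnW ltjn); rewrite ltjn.
by have := h n (ltnSn n); rewrite ltnn.
Qed.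

Lemma v_event_cyl k (S : set R) : measurable S ->
  cyl_events (fun n => events_R (v n)) (v k @^-1` S).
Proof.
move=> mS; exists [:: k], (fun=> v k @^-1` S); split.
  by move=> n; rewrite inE => /eqP ->; exists S.
apply/seteqP; split=> [w h j _//|w h].
by apply: (h k); rewrite /= inE.
Qed.

Lemma v_event2 i j (S1 S2 : set R) : i != j -> measurable S1 -> measurable S2 ->
  cyl_events (fun n => events_R (v n)) (v i @^-1` S1 `&` v j @^-1` S2) /\
  P (v i @^-1` S1 `&` v j @^-1` S2) = (P (v i @^-1` S1) * P (v j @^-1` S2))%E.
Proof.
move=> ij mS1 mS2; pose A k := if k == i then v i @^-1` S1 else v j @^-1` S2.
have AE : v i @^-1` S1 `&` v j @^-1` S2 = \bigcap_(k in [set` [:: i; j]]) A k.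
  apply/seteqP; split=> [w [h1 h2] k|w h].
    by rewrite /= !inE /A => /orP[/eqP ->|/eqP ->]; rewrite ?eqxx// eq_sym (negbTE ij).
  split; first by have := h i; rewrite /A eqxx; apply; rewrite /= inE eqxx.
  by have := h j; rewrite /A eq_sym (negbTE ij); apply; rewrite /= !inE eqxx orbT.
have Aev k : k \in [:: i; j] -> events_R (v k) (A k).
  rewrite !inE /A => /orP[/eqP ->|/eqP ->]; first by rewrite eqxx; exists S1.
  by rewrite eq_sym (negbTE ij); exists S2.
split; first by exists [:: i; j], A.
rewrite AE v_indep//; last by rewrite /= inE ij.
by rewrite !big_cons big_nil mule1 /A eqxx eq_sym (negbTE ij).
Qed.

Lemma v_taus_indep n B V : cyl_events (fun n => events_R (v n)) V ->
  P (cylinder n B `&` V) = (P (cylinder n B) * P V)%E.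
Proof. by move=> cV; rewrite setIC muleC; apply: v_taus => //; exact: cylinder_events. Qed.

Lemma v_sqr_expectation k : has_expectation P (fun w => v k w ^+ 2) sigma2.
Proof.
have E2 : ('E_P[fun w => (v k w ^+ 2)%R] = sigma2%:E)%E.
  rewrite -(v_var k) /variance covariance.unlock v_mean; congr ('E_P[_])%E.
  by apply/funext => w /=; rewrite !mulrfctE /= subr0 expr2.
split=> //; apply/integrableP; split.
  by apply/measurable_EFinP; exact: measurable_funX.
rewrite (_ : (\int[P]_x _)%E = sigma2%:E) ?ltry// -E2 expectation.unlock.
by apply: eq_integral => w _ /=; rewrite ger0_norm// sqr_ge0.
Qed.

(** Integrability comes from the second moment through [|x| <= 1 + x^2]. *)
Lemma v_expectation k : has_expectation P (v k) 0.
Proof.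
split=> //; apply: (le_integrable measurableT _ _
  (has_expectationD P _ _ _ _ (has_expectation_cst P 1) (v_sqr_expectation k)).1).
  exact/measurable_EFinP.
move=> w _ /=; rewrite lee_fin; set x := v k w.
rewrite [leRHS]ger0_norm ?addr_ge0 ?sqr_ge0// -real_normK ?num_real//.
have := normr_ge0 x; set y := `|x|; nra.
Qed.

Lemma cylinder_v_expectation n B k (h : R -> R) b : measurable_fun setT h ->
  has_expectation P (fun w => h (v k w)) b ->
  has_expectation P (fun w => \1_(cylinder n B) w * h (v k w)) (fine (P (cylinder n B)) * b).
Proof.
move=> mh Eh.
rewrite (_ : (fun w => _) = fun w => \1_(cylinder n B) w * (cst 1 w) * h (v k w)); last first.
  by apply/funext => w; rewrite mulr1.
apply: has_expectation_indic_indep => //; first exact: measurable_cylinder.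
  rewrite (_ : (fun w => _) = \1_(cylinder n B)); last by apply/funext => w; rewrite mulr1.
  exact/has_expectation_indic/measurable_cylinder.
move=> S1 S2 mS1 mS2; rewrite preimage_cst; case: ifP => _; last first.
  by rewrite setI0 set0I measure0 mul0e.
rewrite setIT; apply: v_taus_indep.
rewrite (_ : _ @^-1` S2 = v k @^-1` (h @^-1` S2))//; apply: v_event_cyl.
by rewrite -[X in measurable X]setTI; exact: mh.
Qed.

(** For distinct indices the variable [\1_(cylinder n B) * v i] is centered and independent of
    [v j], so the mean is [0 * 0]. *)
Lemma cylinder_vv_expectation n B i j :
  has_expectation P (fun w => \1_(cylinder n B) w * (v i w * v j w))
    (fine (P (cylinder n B)) * (if i == j then sigma2 else 0)).
Proof.
have [<-|ij] := eqVneq i j.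
  apply: (cylinder_v_expectation n B i (fun x => x * x)).
    exact: measurable_funM.
  exact: v_sqr_expectation.
rewrite (_ : (fun w => _) = fun w => \1_(cylinder n B) w * v i w * v j w); last first.
  by apply/funext => w; rewrite mulrA.
have E1 := cylinder_v_expectation n B i id 0 (@measurable_id _ _ _) (v_expectation i).
rewrite mulr0 in E1 *; rewrite -[0](mulr0 0).
apply: has_expectation_indic_indep => //; first exact: measurable_cylinder.
  exact: v_expectation.
move=> S1 S2 mS1 mS2; have [cV PV] := v_event2 _ _ _ _ ij mS1 mS2.
rewrite -setIA v_taus_indep// PV muleA; congr (_ * _)%E.
by rewrite v_taus_indep//; exact: v_event_cyl.
Qed.

(* The linear span of the [v i] multiplied by indicators of events of
   [taus 0, ..., taus n.-1]. *)
Inductive adapted (n : nat) : (T -> R) -> Prop :=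
| adapted0 : adapted n (fun=> 0)
| adaptedS a B i X : adapted n X ->
    adapted n (fun w => a * (\1_(cylinder n B) w * v i w) + X w).

Lemma adaptedD n X Y : adapted n X -> adapted n Y -> adapted n (fun w => X w + Y w).
Proof.
move=> aX aY; elim: aX => [|a B i X' _ IH].
  by rewrite (_ : (fun _ => _) = Y)//; apply/funext => w; rewrite add0r.
rewrite (_ : (fun w => _) = fun w =>
  a * (\1_(cylinder n B) w * v i w) + (X' w + Y w)); first exact: adaptedS.
by apply/funext => w; rewrite addrA.
Qed.

Lemma adaptedZ n r X : adapted n X -> adapted n (fun w => r * X w).
Proof.
elim=> [|a B i X' _ IH].
  rewrite (_ : (fun _ => _) = fun=> 0); first exact: adapted0.
  by apply/funext => w; rewrite mulr0.
rewrite (_ : (fun w => _) = fun w =>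
  (r * a) * (\1_(cylinder n B) w * v i w) + r * X' w); first exact: adaptedS.
by apply/funext => w; ring.
Qed.

Lemma adapted_sum n m (X : 'I_m -> T -> R) : (forall i, adapted n (X i)) ->
  adapted n (fun w => \sum_(i < m) X i w).
Proof.
elim: m X => [|m IH] X aX.
  rewrite (_ : (fun _ => _) = fun=> 0); first exact: adapted0.
  by apply/funext => w; rewrite big_ord0.
rewrite (_ : (fun _ => _) = fun w =>
  \sum_(i < m) X (widen_ord (leqnSn m) i) w + X ord_max w).
  by apply: adaptedD => //; exact: IH.
by apply/funext => w; rewrite big_ord_recr.
Qed.

Lemma adapted_v n i : adapted n (v i).
Proof.
rewrite (_ : v i = fun w => 1 * (\1_(cylinder n (fun=> setT)) w * v i w) + 0).
  exact/adaptedS/adapted0.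
by apply/funext => w; rewrite indicE mem_set// !mul1r addr0.
Qed.

Lemma adapted_leq m n X : (m <= n)%N -> adapted m X -> adapted n X.
Proof.
move=> /subnK <-; elim: (n - m)%N => // k IH /IH.
elim=> [|a B i X' _ aX]; first exact: adapted0.
by rewrite cylinder_widen; exact: adaptedS.
Qed.

Lemma adapted_taus n t X : adapted n X ->
  adapted n.+1 (fun w => (taus n w == t)%:R * X w).
Proof.
elim=> [|a B i X' _ IH].
  rewrite (_ : (fun _ => _) = fun=> 0); first exact: adapted0.
  by apply/funext => w; rewrite mulr0.
rewrite (_ : (fun w => _) = fun w =>
  a * (\1_(cylinder n B `&` taus n @^-1` [set t]) w * v i w) + (taus n w == t)%:R * X' w).
  by rewrite cylinder_extend; exact: adaptedS.
apply/funext => w; rewrite mulrDr; congr (_ + _); rewrite indicI /= !indicE.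
rewrite (_ : (w \in taus n @^-1` [set t]) = (taus n w == t)); first by ring.
by apply/idP/eqP => [/set_mem//|h]; exact: mem_set.
Qed.

(** The constant [c] does not depend on [t]: [taus n] is uncorrelated with products of adapted
    variables. By bilinearity it suffices to treat generators, where the event on [taus n] extends a
    cylinder by one coordinate whose probability factors out. *)
Lemma adapted_expectationM n X Y : adapted n X -> adapted n Y ->
  exists c, has_expectation P (fun w => X w * Y w) c /\
    forall t, has_expectation P (fun w => (taus n w == t)%:R * (X w * Y w))
                (fine (P (taus n @^-1` [set t])) * c).
Proof.
pose good Z := exists c, has_expectation P Z c /\
    forall t, has_expectation P (fun w => (taus n w == t)%:R * Z w)
                (fine (P (taus n @^-1` [set t])) * c).
have good0 : good (fun=> 0).
  exists 0; split=> [|t]; first exact: has_expectation_cst.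
  rewrite mulr0 (_ : (fun w => _) = cst 0); first exact: has_expectation_cst.
  by apply/funext => w; rewrite mulr0.
have goodD a Z1 Z2 : good Z1 -> good Z2 -> good (fun w => a * Z1 w + Z2 w).
  move=> [c1 [E1 F1]] [c2 [E2 F2]]; exists (a * c1 + c2); split=> [|t].
    by apply: has_expectationD => //; exact: has_expectationZ.
  rewrite mulrDr mulrCA (_ : (fun w => _) = fun w =>
    a * ((taus n w == t)%:R * Z1 w) + (taus n w == t)%:R * Z2 w).
    by apply: has_expectationD => //; exact: has_expectationZ.
  by apply/funext => w; rewrite mulrDr mulrCA.
have good_gen B i B' j : good (fun w =>
    (\1_(cylinder n B) w * v i w) * (\1_(cylinder n B') w * v j w)).
  pose C j := B j `&` B' j.
  have genE w : (\1_(cylinder n B) w * v i w) * (\1_(cylinder n B') w * v j w) =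
      \1_(cylinder n C) w * (v i w * v j w).
    by rewrite /C -cylinderI indicI/=; ring.
  under [X in good X]eq_fun do rewrite genE.
  eexists; split; first exact: cylinder_vv_expectation.
  move=> t; rewrite mulrA [X in X * _](_ : _ =
    fine (P (cylinder n.+1 (fun j => if (j < n)%N then C j else [set t])))).
    rewrite (_ : (fun w => _) = fun w => \1_(cylinder n.+1
      (fun j => if (j < n)%N then C j else [set t])) w * (v i w * v j w)).
      exact: cylinder_vv_expectation.
    apply/funext => w; rewrite -cylinder_extend indicI/= !indicE.
    rewrite (_ : (w \in taus n @^-1` [set t]) = (taus n w == t)); first by ring.
    by apply/idP/eqP => [/set_mem//|h]; exact: mem_set.
  rewrite probability_cylinderS ltnn mulrC -fineM; last 2 first.
  - exact/fin_num_measure/measurable_cylinder.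
  - exact/fin_num_measure/measurable_taus.
  congr (fine (_ * _)).
  rewrite !probability_cylinder; apply: eq_big_seq => k.
  by rewrite mem_iota /= => ->.
move=> aX aY; change (good (fun w => X w * Y w)).
elim: aX => [|a B i X' _ IH].
  by under [X in good X]eq_fun do rewrite mul0r.
under [X in good X]eq_fun do rewrite mulrDl -mulrA.
apply: (goodD) => //; elim: aY => [|b B' j Y' _ IH'].
  by under [X in good X]eq_fun do rewrite mulr0.
under [X in good X]eq_fun do rewrite mulrDr mulrCA.
exact: goodD.
Qed.

Lemma vv_expectation i j :
  has_expectation P (fun w => v i w * v j w) (if i == j then sigma2 else 0).
Proof.
have := cylinder_vv_expectation 0 (fun=> setT) i j.
rewrite (_ : cylinder 0 _ = setT); last by apply/seteqP; split.
rewrite probability_setT mul1r (_ : (fun w => _) = fun w => v i w * v j w)//.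
by apply/funext => w; rewrite indicT mul1r.
Qed.

(** * The recursion for the second moments *)

Section SecondMoment.
Variables (tau : nat) (p : nat -> R) (g : nat -> R) (f : nat -> nat -> R).
Variable u : nat -> T -> R.
Hypothesis taus_le : forall n w, (taus n w <= tau)%N.
Hypothesis taus_dist : forall n i, (i <= tau)%N -> P (taus n @^-1` [set i]) = (p i)%:E.
Hypothesis f_mean : forall m, \sum_(t < tau.+1) p t * f m t = 0.
Hypothesis uE : forall k w, u k w =
  \sum_(n < k) g (k - n)%N * v n w - \sum_(n < k) f (k - n)%N (taus n w) * u n w.

Lemma taus_cases n w (h : nat -> R) :
  h (taus n w) = \sum_(t < tau.+1) (taus n w == t)%:R * h t.
Proof.
rewrite (bigD1 (inord (taus n w)))//= inordK ?ltnS// eqxx mul1r big1 ?addr0// => i.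
rewrite -val_eqE /= inordK ?ltnS// eq_sym => /negbTE ->.
by rewrite mul0r.
Qed.

(** The normalization of [p] is read off the law of [taus 0], whose values lie in
    [{0, ..., tau}]. *)
Lemma total_probability : \sum_(t < tau.+1) p t = 1.
Proof.
have E1 : has_expectation P (cst 1) (\sum_(t < tau.+1) p t).
  rewrite (_ : cst 1 = fun w => \sum_(t < tau.+1) \1_(taus 0%N @^-1` [set nat_of_ord t]) w).
    apply: has_expectation_sum => t.
    rewrite (_ : p t = fine (P (taus 0%N @^-1` [set nat_of_ord t]))).
      exact/has_expectation_indic/measurable_taus.
    by rewrite taus_dist// -ltnS.
  apply/funext => w; rewrite /= (taus_cases 0%N w (fun=> 1)); apply: eq_bigr => t _.
  rewrite mulr1 indicE; congr (_%:R); congr nat_of_bool.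
  by apply/eqP/idP => [h|/set_mem//]; exact: mem_set.
exact: has_expectation_inj _ _ _ _ E1 (has_expectation_cst P 1).
Qed.

(** Interpolates between the pure input response at [j = 0] and [u k] at [j = k]. All inputs are
    kept from the start, as adaptedness restricts only the delays; the feedback terms are then added
    one at a time. *)
Let partial k j w : R :=
  \sum_(n < k) g (k - n)%N * v n w - \sum_(n < j) f (k - n)%N (taus n w) * u n w.

Lemma adapted_partial k j : (forall n, (n < j)%N -> adapted n (u n)) ->
  adapted j (partial k j).
Proof.
move=> au; rewrite (_ : partial k j = fun w => \sum_(n < k) g (k - n)%N * v n w +
    \sum_(n < j) \sum_(t < tau.+1) (- f (k - n)%N t) * ((taus n w == t)%:R * u n w)).
  apply: adaptedD; first by apply: adapted_sum => n; exact/adaptedZ/adapted_v.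
  apply: adapted_sum => n; apply: adapted_sum => t; apply: adaptedZ.
  by apply: adapted_leq (ltn_ord n) _; apply: adapted_taus; exact: au.
apply/funext => w; rewrite /partial; congr (_ + _); rewrite -sumrN.
apply: eq_bigr => n _; rewrite (taus_cases n w) mulr_suml -sumrN.
by apply: eq_bigr => t _; ring.
Qed.

Lemma u_partial k : u k = partial k k.
Proof. by apply/funext => w; rewrite uE. Qed.

Lemma adapted_u k : adapted k (u k).
Proof. by elim/ltn_ind: k => k IH; rewrite u_partial; exact: adapted_partial. Qed.

Let s k : R := fine 'E_P[fun w => (u k w * u k w)%R]%E.

Lemma u_sqr_expectation k : has_expectation P (fun w => u k w * u k w) (s k).
Proof.
have [c [Ec _]] := adapted_expectationM _ _ _ (adapted_u k) (adapted_u k).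
by rewrite /s Ec.2.
Qed.

Lemma input_sqr_expectation k :
  has_expectation P (fun w => (\sum_(n < k) g (k - n)%N * v n w) ^+ 2)
    (sigma2 * \sum_(n < k) g (k - n)%N ^+ 2).
Proof.
rewrite (_ : (fun w => _) = fun w => \sum_(n < k) \sum_(m < k)
    (g (k - n)%N * g (k - m)%N) * (v n w * v m w)); last first.
  apply/funext => w; rewrite expr2 mulr_suml; apply: eq_bigr => n _.
  by rewrite mulr_sumr; apply: eq_bigr => m _; ring.
rewrite mulr_sumr (_ : \sum_(n < k) _ = \sum_(n < k) \sum_(m < k)
    (g (k - n)%N * g (k - m)%N) * (if n == m :> nat then sigma2 else 0)); last first.
  apply: eq_bigr => n _; rewrite (bigD1 n)//= eqxx big1 ?addr0; first by ring.
  by move=> m; rewrite -val_eqE /= eq_sym => /negbTE ->; rewrite mulr0.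
apply: has_expectation_sum => n; apply: has_expectation_sum => m.
exact/has_expectationZ/vv_expectation.
Qed.

Lemma partial_sqr_expectation k j :
  has_expectation P (fun w => partial k j w ^+ 2)
    (sigma2 * \sum_(n < k) g (k - n)%N ^+ 2 +
     \sum_(n < j) (\sum_(t < tau.+1) p t * f (k - n)%N t ^+ 2) * s n).
Proof.
elim: j => [|j IH].
  rewrite big_ord0 addr0 (_ : (fun w => _) =
    fun w => (\sum_(n < k) g (k - n)%N * v n w) ^+ 2); first exact: input_sqr_expectation.
  by apply/funext => w; rewrite /partial big_ord0 subr0.
have aX : adapted j (partial k j) by apply: adapted_partial => n _; exact: adapted_u.
have [c [_ Ec]] := adapted_expectationM _ _ _ aX (adapted_u j).
have [c2 [Ec2 Es]] := adapted_expectationM _ _ _ (adapted_u j) (adapted_u j).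
have c2E := has_expectation_inj _ _ _ _ Ec2 (u_sqr_expectation j).
rewrite {}c2E {Ec2} in Es.
set F := f (k - j)%N.
(* The square of [partial k j.+1] is expanded and split over the values of [taus j], so that [F]
   becomes a constant in each piece. *)
rewrite (_ : (fun w => _) = fun w => partial k j w ^+ 2 + \sum_(t < tau.+1)
    ((- 2 * F t) * ((taus j w == t)%:R * (partial k j w * u j w)) +
     F t ^+ 2 * ((taus j w == t)%:R * (u j w * u j w)))); last first.
  apply/funext => w; rewrite {1}/partial big_ord_recr/= opprD addrA -/(partial k j w) -/F.
  transitivity (partial k j w ^+ 2 +
     (-2 * F (taus j w) * (partial k j w * u j w) + F (taus j w) ^+ 2 * (u j w * u j w))).
    by ring.
  congr (_ + _).
  rewrite (taus_cases j w (fun t =>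
    -2 * F t * (partial k j w * u j w) + F t ^+ 2 * (u j w * u j w))).
  by apply: eq_bigr => t _; ring.
rewrite big_ord_recr addrA; apply: has_expectationD => //.
rewrite (_ : _ * s j = \sum_(t < tau.+1) ((- 2 * F t) * (p t * c) + F t ^+ 2 * (p t * s j))).
  apply: has_expectation_sum => t.
  have pE : p t = fine (P (taus j @^-1` [set nat_of_ord t])) by rewrite taus_dist// -ltnS.
  by apply: has_expectationD; apply: has_expectationZ; rewrite pE; [exact: Ec|exact: Es].
(* The cross terms add up to a multiple of the mean of [F] under [p], which is zero. *)
rewrite big_split/= [X in _ = X + _](_ : _ = -2 * c * \sum_(t < tau.+1) p t * F t).
  by rewrite f_mean mulr0 add0r mulr_suml; apply: eq_bigr => t _; rewrite /F; ring.
by rewrite mulr_sumr; apply: eq_bigr => t _; ring.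
Qed.

Lemma second_moment_rec : exists s : nat -> R,
  (forall k, has_expectation P (fun w => u k w ^+ 2) (s k)) /\
  forall k, s k = sigma2 * \sum_(n < k) g (k - n)%N ^+ 2 +
     \sum_(n < k) (\sum_(t < tau.+1) p t * f (k - n)%N t ^+ 2) * s n.
Proof.
have Es k : has_expectation P (fun w => u k w ^+ 2) (s k).
  by rewrite (_ : (fun w => _) = fun w => u k w * u k w);
    [exact: u_sqr_expectation|apply/funext => w; rewrite expr2].
exists s; split=> // k; apply: has_expectation_inj (Es k) _.
by rewrite u_partial; exact: partial_sqr_expectation.
Qed.

End SecondMoment.

End Processes.

(** * The limit of a renewal equation *)

Section Renewal.
Context {R : realType}.
Variables (s b c : nat -> R) (B C M : R).
Hypothesis renewal : forall k, s k = b k + \sum_(n < k) c (k - n)%N * s n.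
Hypotheses (c0 : c 0%N = 0) (c_ge0 : forall m, 0 <= c m) (s_ge0 : forall k, 0 <= s k).
Hypothesis b_nd : nondecreasing_seq b.
Hypothesis b_cvg : b @ \oo --> B.
Hypothesis c_cvg : (fun n => \sum_(m < n) c m) @ \oo --> C.
Hypothesis s_le : forall k, s k <= M.

Lemma renewal_conv k : s k = b k + conv c s k.
Proof.
rewrite renewal convC /conv big_ord_recr/= subnn c0 mulr0 addr0; congr (_ + _).
by apply: eq_bigr => n _; rewrite mulrC.
Qed.

Lemma renewal_nd : nondecreasing_seq s.
Proof.
apply/nondecreasing_seqP; elim/ltn_ind => k IH; rewrite !renewal_conv lerD//.
  exact: b_nd.
rewrite [leRHS]/conv big_ord_recr/= ler_wpDr ?mulr_ge0//.
(* The term at lag 0 would need the very inequality being proved; it is absent because [c 0 = 0]. *)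
apply: ler_sum => -[[|m] /= ltmk] _; first by rewrite c0 !mul0r.
rewrite ler_wpM2l// subSn//; apply: IH.
by rewrite ltn_subrL (leq_trans (ltn0Sn m) ltmk).
Qed.

Lemma renewal_cvg : exists2 L, s @ \oo --> L & L = B + C * L.
Proof.
have /cvg_ex[L sL] : cvgn s.
  by apply: nondecreasing_is_cvgn; [exact: renewal_nd|exists M => _ [k _ <-]].
have s_leL k : s k <= L.
  by rewrite -(cvg_lim _ sL)//; apply: nondecreasing_cvgn_le;
    [exact: renewal_nd|apply/cvg_ex; exists L].
have c_cvgS : (fun n => \sum_(m < n.+1) c m) @ \oo --> C.
  by move: c_cvg; rewrite -(cvg_shiftS (fun n => \sum_(m < n) c m)).
exists L => //; apply/eqP; rewrite eq_le; apply/andP; split.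
  (* Upper bound for [L]: every past value is at most [L]. *)
  have lim1 : (fun k => b k + (\sum_(m < k.+1) c m) * L) @ \oo --> B + C * L.
    by apply: cvgD => //; apply: cvgM => //; exact: cvg_cst.
  apply: (ler_cvg_to sL lim1); apply: nearW => k.
  rewrite (renewal_conv k) lerD2l /conv mulr_suml; apply: ler_sum => m _.
  by rewrite ler_wpM2l.
(* Lower bound: only lags up to a fixed [N] are kept, and there [s (k - m)] is at least [s (k - N)].
   First [k], then [N], tends to infinity. *)
have lowN N : B + (\sum_(m < N.+1) c m) * L <= L.
  have lim2 : (fun k => b k + (\sum_(m < N.+1) c m) * s (k - N)%N) @ \oo -->
      B + (\sum_(m < N.+1) c m) * L.
    apply: cvgD => //; apply: cvgM; first exact: cvg_cst.
    exact: (cvg_comp _ s (cvg_subnr N) sL).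
  apply: (ler_cvg_to lim2 sL); near=> k.
  have leNk : (N <= k)%N by near: k; exact: nbhs_infty_ge.
  rewrite (renewal_conv k) lerD2l /conv.
  apply: (@le_trans _ _ (\sum_(m < N.+1) c m * s (k - m)%N)).
    rewrite mulr_suml; apply: ler_sum => m _; rewrite ler_wpM2l//.
    by apply: renewal_nd; rewrite leq_sub2l// -ltnS.
  have -> : \sum_(m < k.+1) c m * s (k - m)%N =
      \sum_(m < N.+1 + (k - N)) c m * s (k - m)%N by rewrite addSn subnKC.
  by rewrite big_split_ord/= lerDl sumr_ge0// => m _; rewrite mulr_ge0.
have lim3 : (fun N => B + (\sum_(m < N.+1) c m) * L) @ \oo --> B + C * L.
  by apply: cvgD; [exact: cvg_cst|apply: cvgM => //; exact: cvg_cst].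
by apply: (ler_cvg_to lim3 (cvg_cst L)); apply: nearW.
Unshelve. all: by end_near. Qed.

Lemma renewal_limit : s @ \oo --> B / (1 - C).
Proof.
have [L sL LE] := renewal_cvg.
have LB : L * (1 - C) = B by rewrite mulrBr mulr1 {1}LE (mulrC C) addrK.
have [C1|C1] := eqVneq (1 - C) 0; last by rewrite -LB mulfK.
rewrite C1 invr0 mulr0.
have B0 : B = 0 by rewrite -LB C1 mulr0.
(* The nondecreasing [b] has limit 0, so it is nonpositive; with the earlier values zero, [s k] is
   at most [b k]. *)
have s0 k : s k = 0.
  elim/ltn_ind: k => k IH.
  have b_le0 : b k <= 0.
    rewrite -B0 -(cvg_lim _ b_cvg)//; apply: nondecreasing_cvgn_le => //.
    by apply/cvg_ex; exists B.
  apply/eqP; rewrite eq_le s_ge0 andbT renewal big1 ?addr0// => n _.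
  by rewrite IH ?mulr0.
by rewrite (_ : s = cst 0); [exact: cvg_cst|exact/funext].
Qed.

End Renewal.

Theorem theorem2
  (d : measure_display) (T : measurableType d) (R : realType)
  (P : probability T R)
  (nP dP nK dK : {poly R}) (tau : nat) (alpha p phi : nat -> R)
  (taus : nat -> T -> nat) (v : nat -> T -> R) (sigma2 : R)
  (* P strictly proper, K proper (normalized representations) *)
  (hnP0 : nP`_0 = 0) (hdP0 : dP`_0 = 1) (hdK0 : dK`_0 = 1)
  (* {tau_n} i.i.d. with values in {0,...,tau} and Pr{tau_n = i} = p_i *)
  (htau_range : forall n t, (taus n t <= tau)%N)
  (htau_meas : forall n i, measurable (taus n @^-1` [set i]))
  (htau_dist : forall n i, (i <= tau)%N -> P (taus n @^-1` [set i]) = (p i)%:E)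
  (htau_indep : mutually_indep P (fun n => events_nat (taus n)))
  (* the loop is mean-square input-output stable *)
  (hstab : ms_io_stable P nP dP nK dK tau alpha p taus)
  (* {v(k)} i.i.d., zero mean, variance sigma2, independent of {tau_n} *)
  (hv_meas : forall k, measurable_fun setT (v k))
  (hv_indep : mutually_indep P (fun n => events_R (v n)))
  (hv_ident : forall k (B : set R), measurable B ->
                P (v k @^-1` B) = P (v 0%N @^-1` B))
  (hv_mean : forall k, ('E_P[v k] = 0)%E)
  (hv_var : forall k, 'V_P[v k] = sigma2%:E)
  (hv_tau : indep_processes_R_nat P v taus)
  (* Phi(z) = sum_{i<=tau} phi_i z^{-i}: minimum-phase spectral factor *)
  (hPhi_min : minimum_phase (\poly_(i < tau.+1) phi i))
  (hPhi_spec : forall z : R[i], z != 0 ->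
     zval (\poly_(i < tau.+1) phi i) z^-1 * zval (\poly_(i < tau.+1) phi i) z =
     (2 : R[i])^-1 *
     \sum_(i1 < tau.+1) \sum_(i2 < tau.+1)
        (real_complex R (alpha i1) * z ^+ i1 - real_complex R (alpha i2) * z ^+ i2) *
        (real_complex R (alpha i1) * z ^- i1 - real_complex R (alpha i2) * z ^- i2) *
        real_complex R (p i1 * p i2)) :
  (fun k => ('E_P[fun t => (rv_u nP dP nK dK tau alpha taus v k t ^+ 2)%R])%E)
    @ \oo -->
  ((H2sq (G_num nP nK) (G_den nP dP nK dK tau alpha p) /
    (1 - H2sq ((\poly_(i < tau.+1) phi i) * G_num nP nK)
              (G_den nP dP nK dK tau alpha p))) * sigma2)%:E.
Proof.
set N := G_num nP nK; set D := G_den nP dP nK dK tau alpha p.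
have D0 : D`_0 = 1.
  by rewrite coefD !coefM !big_ord1 hdP0 hdK0 subn0 coefM big_ord1 hnP0 !mul0r addr0 mulr1.
have Dneq0 : D != 0 by apply: contra_eq_neq D0 => ->; rewrite coef0 eq_sym oner_neq0.
have [g Dg] := exists_conv _ (nth 0 D) (nth 0 N) D0.
have N0 : N`_0 = 0 by rewrite coefM big_ord1 hnP0 mul0r.
have g0 : g 0%N = 0.
  by have := congr1 (@^~ 0%N) Dg; rewrite /conv big_ord1 D0 mul1r N0.
have [M gM] := stable_tf_summable _ _ _ D0 Dg hstab.1.
have sum_p := total_probability P taus htau_meas tau p htau_range htau_dist.
have dev_mean m : \sum_(t < tau.+1) p t * tap_dev tau alpha p g m t = 0.
  under eq_bigr do rewrite mulrBr.
  by rewrite sumrB -mulr_suml sum_p mul1r subrr.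
have [s [Es s_rec]] := second_moment_rec P taus v sigma2 htau_meas htau_indep hv_meas
  hv_indep hv_mean hv_var hv_tau tau p g (tap_dev tau alpha p g)
  (rv_u nP dP nK dK tau alpha taus v) htau_range htau_dist dev_mean
  (fun k w => loop_u_rec nP dP nK dK tau alpha p (fun n => taus n w) (fun n => v n w)
     hnP0 hdP0 hdK0 g k Dg (htau_range^~ w)).
have Ev2 k := v_sqr_expectation P v sigma2 hv_meas hv_mean hv_var k.
have expectation_sqr_ge0 (X : T -> R) a :
    has_expectation P (fun w => X w ^+ 2) a -> 0 <= a.
  by move=> [_ EX]; rewrite -lee_fin -EX; apply: expectation_ge0 => w; exact: sqr_ge0.
have sigma2_ge0 : 0 <= sigma2 := expectation_sqr_ge0 _ _ (Ev2 0%N).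
have p_ge0 (t : 'I_tau.+1) : 0 <= p t.
  by rewrite -lee_fin -(htau_dist 0%N)// -ltnS.
(* The given input is one of those that stability quantifies over, which bounds the second moments
   of [u]. *)
have v_adm : admissible_input P taus v.
  split=> //.
  - move=> k l kl; have := vv_expectation P taus v sigma2 htau_meas hv_meas hv_indep
      hv_mean hv_var hv_tau k l.
    by rewrite (negbTE kl) => -[].
  - by exists sigma2 => k; rewrite (Ev2 k).2.
have [M' sM'] := hstab.2 v v_adm.
rewrite (_ : (fun k => _) = EFin \o s); last first.
  by apply/funext => k; rewrite /= (Es k).2.
apply: cvg_EFin; first exact: nearW.
(* Since [g 0 = 0], the reversed sum is the partial energy through index [k], which is monotone in
   [k] and fits Parseval after a shift. *)
have g_sum k : \sum_(n < k) g (k - n)%N ^+ 2 = \sum_(m < k.+1) g m ^+ 2.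
  rewrite big_ord_recl g0 expr0n add0r (reindex_inj rev_ord_inj) /=.
  by apply: eq_bigr => m _; rewrite subKn.
rewrite mulrAC; apply: (@renewal_limit _ s
  (fun k => sigma2 * \sum_(n < k) g (k - n)%N ^+ 2) (tap_var tau alpha p g) _ _ M').
- exact: s_rec.
- have tap0 i : tap alpha g i 0%N = 0.
    by rewrite /tap; case: i => // ; rewrite subnn g0 mulr0.
  rewrite /tap_var big1// => i _; rewrite tap0 big1 ?subr0 ?expr0n ?mulr0// => j _.
  by rewrite tap0 mulr0.
- by move=> m; apply: sumr_ge0 => t _; rewrite mulr_ge0// sqr_ge0.
- by move=> k; exact: expectation_sqr_ge0 (Es k).
- apply/nondecreasing_seqP => k; rewrite !g_sum [in leRHS]big_ord_recr/=.
  by rewrite ler_wpM2l// lerDl sqr_ge0.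
- rewrite [X in _ --> X]mulrC; under eq_fun do rewrite g_sum.
  apply: cvgM; first exact: cvg_cst.
  have [_] := parseval _ _ _ _ Dneq0 Dg gM.
  by rewrite -(cvg_shiftS (fun n => \sum_(i < n) g i ^+ 2)).
- exact: tap_var_series hPhi_spec _ _ _ _ Dneq0 Dg gM sum_p.
- by move=> k; rewrite -lee_fin -(Es k).2; exact: (sM' k).2.
Qed.
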